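(* Let $M$ be a semifinite von Neumann algebra with a faithful semifinite normal trace $\operatorname{tr}$. Let $p$ and $q$ be positive real numbers such that $p^{-1}+q^{-1}=1$, and let $a,b\in M$ be positive operators with $\operatorname{tr}(a)<\infty$ and $\operatorname{tr}(b)<\infty$. Then $$\operatorname{tr}(|ab|)\;=\;p^{-1}\operatorname{tr}(a^p)+q^{-1}\operatorname{tr}(b^q)$$ if and only if $b^q=a^p$.
   Context: For $z\in M$, $|z|=(z^*z)^{1/2}$. The trace is defined on the positive cone $M^+$ with values in $[0,\infty]$. *)

(* Defs.v *)
From HB Require Import structures.
From mathcomp Require Import all_boot all_order all_algebra.
From mathcomp Require Import all_classical all_reals all_analysis.
From mathcomp Require Export complex.

Set Implicit Arguments.
Unset Strict Implicit.
Unset Printing Implicit Defensive.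

Import Order.TTheory GRing.Theory Num.Theory.
Import numFieldNormedType.Exports.

Local Open Scope classical_set_scope.
Local Open Scope complex_scope.
Local Open Scope ring_scope.

(* Complex Hilbert spaces; the inner product is linear in its first argument.
   Norms in a normedModType R[i] are elements of R[i]. *)
HB.mixin Record CompleteNormedModule_isHilbert (R : realType) H
    of CompleteNormedModule R[i] H := {
  inner : H -> H -> R[i] ;
  inner_linearl : forall (c : R[i]) (x y z : H),
    inner (c *: x + y) z = c * inner x z + inner y z ;
  inner_conj : forall x y : H, inner x y = Num.conj (inner y x) ;
  inner_norm : forall x : H, inner x x = `|x| ^+ 2
}.

#[short(type="hilbertType")]
HB.structure Definition Hilbert (R : realType) :=
  { H of CompleteNormedModule_isHilbert R H & CompleteNormedModule R[i] H }.

Section Operators.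
Context {R : realType} {H : hilbertType R}.
Implicit Types (a b c e f x y z : H -> H) (M S : set (H -> H)).

Definition bounded_op a := linear a /\ continuous a.

(* The adjoint of a bounded operator (it exists by Riesz representation, and is
   unique); 0 for a map without an adjoint. *)
Definition adj a : H -> H :=
  xget 0 [set b : H -> H | forall u v : H, inner (a u) v = inner u (b v)].

(* The order of R[i] makes 0 <= z say that z is real and nonnegative. *)
Definition positive_op a := bounded_op a /\ forall u : H, 0 <= inner (a u) u.

Definition op_le a b := positive_op (b - a).

Definition spectrum a : set R[i] :=
  [set l | ~ exists b, [/\ bounded_op b,
             (a - l *: idfun) \o b = idfun & b \o (a - l *: idfun) = idfun]].

Definition op_poly (P : {poly R}) a : H -> H :=
  \sum_(i < size P) (P`_i)%:C *: iter i a.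

(* Continuous functional calculus g(a) of a self-adjoint operator a: the norm
   limit of P_n(a) for real polynomials P_n converging to g uniformly on the
   spectrum of a (which is real). *)
Definition is_cfc a (g : R -> R) c :=
  bounded_op c /\
  forall eps : R, 0 < eps -> exists P : {poly R},
    (forall t : R, spectrum a t%:C -> `|P.[t] - g t| <= eps) /\
    (forall u : H, `|op_poly P a u - c u| <= eps%:C * `|u|).

Definition cfc a (g : R -> R) : H -> H := xget 0 [set c | is_cfc a g c].

Definition op_pow a (r : R) : H -> H := cfc a (fun t => t `^ r).

Definition op_abs z : H -> H := op_pow (adj z \o z) 2^-1.

Definition commutant S : set (H -> H) :=
  [set x | bounded_op x /\ forall s, S s -> x \o s = s \o x].

Record von_neumann_algebra M : Prop := VonNeumannAlgebra {
  vna_bounded : forall x, M x -> bounded_op x ;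
  vna_add : forall x y, M x -> M y -> M (x + y) ;
  vna_scale : forall (l : R[i]) x, M x -> M (l *: x) ;
  vna_mul : forall x y, M x -> M y -> M (x \o y) ;
  vna_adj : forall x, M x -> M (adj x) ;
  vna_bicommutant : commutant (commutant M) = M
}.

Definition pos_cone M : set (H -> H) := [set x | M x /\ positive_op x].

Definition projection_in M e := [/\ M e, e \o e = e & adj e = e].

Definition mvn_equiv M e f :=
  exists v, [/\ M v, adj v \o v = e & v \o adj v = f].

Definition finite_projection M e :=
  projection_in M e /\
  forall f, projection_in M f -> op_le f e -> mvn_equiv M e f -> f = e.

Definition semifinite_algebra M :=
  forall z, projection_in M z -> commutant M z -> z <> 0 ->
  exists e, [/\ finite_projection M e, e <> 0 & op_le e z].

(* Traces on M^+ are represented by functions on all maps H -> H, of which only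
   the values on pos_cone M are constrained. *)
Record is_trace M (tr : (H -> H) -> \bar R) : Prop := IsTrace {
  trace_ge0 : forall x, pos_cone M x -> (0 <= tr x)%E ;
  trace_add : forall x y, pos_cone M x -> pos_cone M y ->
    tr (x + y) = (tr x + tr y)%E ;
  (* here 0 * +oo = 0 *)
  trace_scale : forall (l : R) x, 0 <= l -> pos_cone M x ->
    tr (l%:C *: x) = (l%:E * tr x)%E ;
  trace_adj : forall x, M x -> tr (adj x \o x) = tr (x \o adj x)
}.

Definition trace_faithful M (tr : (H -> H) -> \bar R) :=
  forall x, pos_cone M x -> tr x = 0%E -> x = 0.

Definition trace_semifinite M (tr : (H -> H) -> \bar R) :=
  forall x, pos_cone M x -> x <> 0 ->
  exists y, [/\ pos_cone M y, y <> 0, op_le y x & (tr y < +oo)%E].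

Definition op_directed (D : set (H -> H)) :=
  D !=set0 /\
  forall x y, D x -> D y -> exists z, [/\ D z, op_le x z & op_le y z].

Definition op_lub M (D : set (H -> H)) s :=
  [/\ pos_cone M s, (forall x, D x -> op_le x s) &
      forall y, pos_cone M y -> (forall x, D x -> op_le x y) -> op_le s y].

Definition trace_normal M (tr : (H -> H) -> \bar R) :=
  forall (D : set (H -> H)) s, D `<=` pos_cone M -> op_directed D ->
  op_lub M D s -> tr s = ereal_sup (tr @` D).

End Operators.

(* Main.v *)
(* Write [a^r] for powers and [|x|_2^2 = tr (x^* x)].  For a contraction [v] of [M] the function
   [g_v(s) = |a^(p s / 2) v b^(q (1 - s) / 2)|_2^2] is finite on [0, 1] because one of the two
   exponents is at least 1/2, and moving fractional powers around the trace shows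
   [g_v((s + t) / 2) = Re <x_s, x_t> <= (g_v(s) + g_v(t)) / 2], where [g_v(s) = |x_s|_2^2].
   A bounded midpoint convex function is convex, so
   [g_v(1/p) <= p^-1 tr(a^p) + q^-1 tr(b^q)].  For [v = 1] the gap at the midpoint [s = 1/2] is
   exactly [|b^(q/2) - a^(p/2)|_2^2 / 2], and convexity carries a fixed fraction of it to [1/p].
   By Cauchy-Schwarz [tr (u^* a b) <= (g_1(1/p) + g_u(1/p)) / 2] for every contraction [u]; taking
   [u = a b (|ab| + e)^-1] and letting [e] tend to 0 (normality, in place of a polar
   decomposition) bounds [tr |ab|] by the sum minus a multiple of that gap.  Equality therefore
   forces [b^(q/2) = a^(p/2)] by faithfulness.  Conversely, if [c = a^p = b^q] then
   [ab = c^(1/p) c^(1/q) = c]. *)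
Require Import Defs.
From HB Require Import structures.
From mathcomp Require Import all_boot all_order all_algebra.
From mathcomp Require Import all_classical all_reals all_analysis.
From mathcomp Require Import ring lra.

Set Implicit Arguments.
Unset Strict Implicit.
Unset Printing Implicit Defensive.

Import Order.TTheory GRing.Theory Num.Theory.
Import numFieldNormedType.Exports.

Local Open Scope classical_set_scope.
Local Open Scope complex_scope.
Local Open Scope ring_scope.


(** The trace is only a function on the positive cone with values in [0, +oo]. The trace inner
    product is therefore obtained by polarization ([tdot]), and each identity about it is arranged
    so that traces of positive operators are added, never subtracted. What makes powers move around
    the trace is that [tdot x y] depends on [star y * x] alone, together with its invariance under
    adjoints.

    A finite trace of [a] controls a^r in square norm only for r >= 1/2. The path is parametrized so
    that both exponents equal 1/2 at s = 1/p, the point where the pairing with [u] lives; below 1/2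
    a power can only be used next to a square integrable factor.

    The surviving fraction of the gap is min(1/p, 1/q) for v = 1. It is halved at the end, because
    the path of [u] has the other half of the weight and contributes no gap.

    The functional calculus is given by polynomial approximation on the spectrum, so everything
    about it rests on the bound of |P(x)| by the supremum of |P| there. This bound comes from
    operators that are bounded below: factorization over the complex numbers produces them, and
    positivity turns them into norm bounds. *)

Section HilbertSpace.
Context {R : realType} {H : hilbertType R}.
Implicit Types x y z u v : H.

Definition rdot x y : R := complex.Re (inner x y).

Lemma innerDl x y z : inner (x + y) z = inner x z + inner y z.
Proof. by rewrite -[x in LHS]scale1r inner_linearl mul1r. Qed.

Lemma inner0l z : inner 0 z = 0 :> R[i].
Proof. by apply: (addrI (inner 0 z)); rewrite -innerDl !addr0. Qed.

Lemma innerZl (c : R[i]) x z : inner (c *: x) z = c * inner x z.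
Proof. by rewrite -[_ *: _]addr0 inner_linearl inner0l addr0. Qed.

Lemma innerDr x y z : inner x (y + z) = inner x y + inner x z.
Proof. by rewrite inner_conj innerDl rmorphD /= -!inner_conj. Qed.

Lemma innerZr (c : R[i]) x z : inner x (c *: z) = Num.conj c * inner x z.
Proof. by rewrite inner_conj innerZl rmorphM /= -inner_conj. Qed.

Lemma rdotC x y : rdot x y = rdot y x.
Proof. by rewrite /rdot inner_conj; case: (inner y x). Qed.

Lemma rdotDl x y z : rdot (x + y) z = rdot x z + rdot y z.
Proof. by rewrite /rdot innerDl; case: (inner x z); case: (inner y z). Qed.

Lemma rdotDr x y z : rdot x (y + z) = rdot x y + rdot x z.
Proof. by rewrite rdotC rdotDl !(rdotC x). Qed.

Lemma rdotZl (t : R) x y : rdot (t%:C *: x) y = t * rdot x y.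
Proof. by rewrite /rdot innerZl; case: (inner x y) => a b /=; rewrite mul0r subr0. Qed.

Lemma rdotZr (t : R) x y : rdot x (t%:C *: y) = t * rdot x y.
Proof. by rewrite rdotC rdotZl rdotC. Qed.

Lemma rdotNl x y : rdot (- x) y = - rdot x y.
Proof.
have -> : - x = (-1)%:C *: x by rewrite rmorphN1 scaleN1r.
by rewrite rdotZl mulN1r.
Qed.

Lemma rdotNr x y : rdot x (- y) = - rdot x y.
Proof. by rewrite rdotC rdotNl rdotC. Qed.

Lemma rdotBl x y z : rdot (x - y) z = rdot x z - rdot y z.
Proof. by rewrite rdotDl rdotNl. Qed.

Lemma rdotBr x y z : rdot x (y - z) = rdot x y - rdot x z.
Proof. by rewrite rdotDr rdotNr. Qed.

Lemma Im_inner x y : complex.Im (inner x y) = rdot x ('i *: y).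
Proof. by rewrite /rdot innerZr; case: (inner x y) => s t /=; ring. Qed.

(** The second argument is conjugate linear, so [c = 1] yields the real part and [c = 'i] the
    imaginary part. Complex identities can thus be proved by real estimates. *)
Lemma inner_rdot x y x' y' : (forall c : R[i], rdot x (c *: y) = rdot x' (c *: y')) ->
  inner x y = inner x' y'.
Proof.
move=> h; apply/eqP; rewrite eq_complex !Im_inner h eqxx andbT.
by have := h 1; rewrite !scale1r /rdot => ->.
Qed.

Definition nrm x : R := Num.sqrt (rdot x x).

Lemma normE x : `|x| = (nrm x)%:C.
Proof.
rewrite /nrm /rdot inner_norm; have := normr_ge0 x; case: `|x| => s t.
rewrite lecE /= => /andP[/eqP -> s0].
by rewrite mulr0 subr0 -expr2 sqrtr_sqr ger0_norm.
Qed.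

Lemma rdot_ge0 x : 0 <= rdot x x.
Proof.
rewrite /rdot inner_norm normE.
by rewrite /= mulr0 subr0 -expr2 sqr_ge0.
Qed.

Lemma nrm_ge0 x : 0 <= nrm x. Proof. exact: sqrtr_ge0. Qed.

Lemma nrm_sqr x : nrm x ^+ 2 = rdot x x.
Proof. by rewrite sqr_sqrtr ?rdot_ge0. Qed.

Lemma nrm_eq0 x : nrm x = 0 -> x = 0.
Proof. by move=> h; apply/eqP; rewrite -normr_eq0 normE h. Qed.

Lemma nrm0 : nrm 0 = 0.
Proof. by rewrite /nrm /rdot inner0l sqrtr0. Qed.

Lemma nrmD x y : nrm (x + y) <= nrm x + nrm y.
Proof. by have := ler_normD x y; rewrite !normE -rmorphD lecR. Qed.

Lemma nrmN x : nrm (- x) = nrm x.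
Proof. by rewrite /nrm rdotNl rdotNr opprK. Qed.

Lemma nrmB x y : nrm (x - y) = nrm (y - x).
Proof. by rewrite -nrmN opprB. Qed.

Lemma nrmZ (t : R) x : nrm (t%:C *: x) = `|t| * nrm x.
Proof. by rewrite /nrm rdotZl rdotZr mulrA -expr2 sqrtrM ?sqr_ge0 // sqrtr_sqr. Qed.

Lemma nrmZi (c : R[i]) x : nrm (c *: x) = complex.Re `|c| * nrm x.
Proof.
have := normE (c *: x); rewrite normrZ normE normc_def.
by rewrite -rmorphM => /complexI <-.
Qed.

(** The discriminant of a nonnegative quadratic polynomial. [B] is an arbitrary function, so the
    lemma serves forms [rdot (y u) v] of positive operators as well as the inner product. *)
Lemma psd_cauchy (B : H -> H -> R) x y :
  (forall t : R, 0 <= B x x + 2 * t * B x y + t ^+ 2 * B y y) ->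
  B x y ^+ 2 <= B x x * B y y.
Proof.
set a := B x x; set b := B x y; set c := B y y => h.
have a0 : 0 <= a by have := h 0; rewrite mulr0 mul0r expr0n mul0r !addr0.
have c0 : 0 <= c.
  rewrite leNgt; apply/negP => c0.
  have b2 : 0 <= b ^+ 2 by apply: sqr_ge0.
  (* This makes [t * (- c)] exceed [2 * |b| + a]; as [t >= 1], the term [t ^+ 2 * c] outweighs the
     other two. *)
  pose t := 2 * `|b| / (- c) + (a + 1) / (- c) + 1.
  have := h t; suff : a + 2 * t * b + t ^+ 2 * c < 0 by lra.
  have hb : b <= `|b| by apply: ler_norm.
  have nb : 0 <= `|b| by apply: normr_ge0.
  have c0' : 0 < - c by lra.
  have t1 : 1 <= t by rewrite /t lerDr addr_ge0 // divr_ge0 //; lra.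
  have e : t * (- c) = 2 * `|b| + (a + 1) - c.
    by rewrite /t; field; lra.
  have : 2 * t * b <= 2 * t * `|b| by rewrite ler_wpM2l //; lra.
  nra.
have [c00|c00] := eqVneq c 0.
  rewrite c00 mulr0; have [->|b0] := eqVneq b 0; first by rewrite expr0n.
  (* At this point the polynomial, now affine, takes the value -1. *)
  have := h (- (a + 1) / (2 * b)).
  rewrite c00 mulr0 addr0.
  have -> : 2 * (- (a + 1) / (2 * b)) * b = - (a + 1) by field.
  lra.
have {c0}c0 : 0 < c by rewrite lt_neqAle eq_sym c00.
have := h (- b / c).
have -> : a + 2 * (- b / c) * b + (- b / c) ^+ 2 * c = (a * c - b ^+ 2) / c by field.
by rewrite pmulr_lge0 ?invr_gt0 // subr_ge0.
Qed.

Lemma rdot_cauchy x y : `|rdot x y| <= nrm x * nrm y.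
Proof.
rewrite -(@ler_pXn2r _ 2) ?nnegrE ?mulr_ge0 ?nrm_ge0 //.
rewrite real_normK ?num_real // exprMn !nrm_sqr; apply: psd_cauchy => t.
have := rdot_ge0 (x + t%:C *: y).
rewrite rdotDl !rdotDr !rdotZl !rdotZr (rdotC y x); congr (_ <= _); ring.
Qed.

End HilbertSpace.


(** * Bounded operators with an adjoint, as a ring with involution *)

Section BoundedOperators.
Context {R : realType} {H : hilbertType R}.

Lemma bounded_opP (f : H -> H) :
  bounded_op f <-> linear f /\ exists C : R, forall u, nrm (f u) <= C * nrm u.
Proof.
split=> -[lf hf]; split=> //.
  pose F : {linear H -> H} := HB.pack f (GRing.isLinear.Build _ _ _ _ f lf).
  have /linear_boundedP : bounded_near F (nbhs (0 : H)).
    by apply/linear_bounded_continuous.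
  move=> /pinfty_ex_gt0[r r0 hr]; exists (complex.Re r) => u.
  rewrite -lecR rmorphM /= -!normE.
  suff -> : (complex.Re r)%:C = r by exact: hr.
  by rewrite RRe_real // gtr0_real.
case: hf => C hC.
pose F : {linear H -> H} := HB.pack f (GRing.isLinear.Build _ _ _ _ f lf).
suff : continuous F by [].
apply/linear_bounded_continuous/linear_boundedP; near=> r => u.
have r0 : C%:C <= r by near: r; apply: nbhs_pinfty_ge; rewrite complex_real.
apply: (@le_trans _ _ (C%:C * `|u|)); last by rewrite ler_wpM2r.
by rewrite !normE -rmorphM lecR; exact: hC.
Unshelve. all: end_near. Qed.

Definition is_adj (f g : H -> H) := forall u v, inner (f u) v = inner u (g v).

(* Asking for the existence of an adjoint makes the Riesz representation theorem unnecessary. *)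
Record bh := Bh { bh_fun :> H -> H ; bh_bounded : bounded_op bh_fun ;
  bh_adj : exists g, is_adj bh_fun g }.

Lemma bh_ext (x y : bh) : (forall u, x u = y u) -> x = y.
Proof.
case: x y => [f bf af] [g bg ag] /= /funext e; rewrite e in bf af *.
by rewrite (Prop_irrelevance bf bg) (Prop_irrelevance af ag).
Qed.

HB.instance Definition _ := gen_eqMixin bh.
HB.instance Definition _ := gen_choiceMixin bh.

Lemma inner_inj (x y : H) : (forall z, inner x z = inner y z) -> x = y.
Proof.
move=> h; apply/eqP; rewrite -subr_eq0; apply/eqP/nrm_eq0.
rewrite /nrm rdotBl {1 2}/rdot h; by rewrite subrr sqrtr0.
Qed.

Lemma is_adj_sym f g : is_adj f g -> is_adj g f.
Proof. by move=> h u v; rewrite inner_conj -h -inner_conj. Qed.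

Lemma is_adj_uniq f g g' : is_adj f g -> is_adj f g' -> g = g'.
Proof.
move=> h h'; apply: funext => v; apply: inner_inj => u.
by rewrite inner_conj -h h' -inner_conj.
Qed.

Lemma is_adj_linear f g : is_adj f g -> linear g.
Proof.
move=> /is_adj_sym h c u v; apply: inner_inj => z.
by rewrite h innerDl innerZl !(innerDl, innerZl) !h.
Qed.

Lemma is_adj_bounded f g : bounded_op f -> is_adj f g -> bounded_op g.
Proof.
move=> /bounded_opP[lf [C hC]] h; apply/bounded_opP; split.
  exact: is_adj_linear h.
exists C => u; have [->|g0] := eqVneq (nrm (g u)) 0.
  (* The bound [C] may be negative, but then every norm vanishes. *)
  have [c0|c0] := leP 0 C; first by rewrite mulr_ge0 ?nrm_ge0.
  have hz (v : H) : nrm v = 0.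
    have := hC v; have := nrm_ge0 (f v); have := nrm_ge0 v; nra.
  by rewrite hz mulr0.
have g1 : 0 < nrm (g u) by rewrite lt_neqAle eq_sym g0 nrm_ge0.
rewrite -(ler_pM2l g1) -expr2 nrm_sqr.
have -> : rdot (g u) (g u) = rdot (f (g u)) u by rewrite /rdot h.
apply: le_trans (ler_norm _) _; apply: le_trans (rdot_cauchy _ _) _.
by rewrite mulrA (mulrC (nrm _) C) ler_wpM2r ?nrm_ge0.
Qed.

Lemma is_adj_adj f g : is_adj f g -> adj f = g.
Proof.
move=> h; rewrite /adj; case: xgetP => [g' _ h'|/(_ g)//].
exact: is_adj_uniq h' h.
Qed.

Lemma linearfD (x : bh) u v : x (u + v) = x u + x v.
Proof. by have [l _] := bh_bounded x; have := l 1 u v; rewrite !scale1r. Qed.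
Lemma linearf0 (x : bh) : x 0 = 0.
Proof. by apply: (addrI (x 0)); rewrite -linearfD !addr0. Qed.
Lemma linearfZ (x : bh) c u : x (c *: u) = c *: x u.
Proof. by have [l _] := bh_bounded x; have := l c u 0; rewrite linearf0 !addr0. Qed.

Lemma bh_bound (x : bh) : exists2 C : R, 0 <= C & forall u, nrm (x u) <= C * nrm u.
Proof.
have /bounded_opP[_ [C hC]] := bh_bounded x.
exists `|C| => // u; apply: le_trans (hC u) _.
by rewrite ler_wpM2r ?nrm_ge0 ?ler_norm.
Qed.

Fact bounded_zero : bounded_op (fun=> 0 : H).
Proof.
apply/bounded_opP; split; first by move=> c u v; rewrite scaler0 addr0.
by exists 0 => u; rewrite nrm0 mul0r.
Qed.
Fact adj_zero : exists g, is_adj (fun=> 0 : H) g.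
Proof. by exists (fun=> 0) => u v; rewrite inner0l inner_conj inner0l rmorph0. Qed.
Definition bh_zero := Bh bounded_zero adj_zero.

Fact bounded_one : bounded_op (id : H -> H).
Proof. by apply/bounded_opP; split=> //; exists 1 => u; rewrite mul1r. Qed.
Fact adj_one : exists g, is_adj (id : H -> H) g.
Proof. by exists id. Qed.
Definition bh_one := Bh bounded_one adj_one.

Fact bounded_add (x y : bh) : bounded_op (fun u => x u + y u).
Proof.
apply/bounded_opP; split.
  by move=> c u v; rewrite !linearfD !linearfZ scalerDr addrACA.
have [C _ hC] := bh_bound x; have [D _ hD] := bh_bound y; exists (C + D) => u.
by rewrite mulrDl; apply: le_trans (nrmD _ _) _; apply: lerD.
Qed.
Fact adj_add (x y : bh) : exists g, is_adj (fun u => x u + y u) g.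
Proof.
have [f hf] := bh_adj x; have [g hg] := bh_adj y.
by exists (fun u => f u + g u) => u v; rewrite innerDl innerDr hf hg.
Qed.
Definition bh_add x y := Bh (bounded_add x y) (adj_add x y).

Fact bounded_scale (c : R[i]) (x : bh) : bounded_op (fun u => c *: x u).
Proof.
apply/bounded_opP; split.
  by move=> d u v; rewrite linearfD linearfZ scalerDr !scalerA mulrC.
have [C _ hC] := bh_bound x; exists (complex.Re `|c| * C) => u.
rewrite nrmZi -mulrA ler_wpM2l //.
by have := normr_ge0 c; rewrite lecE => /andP[].
Qed.
Fact adj_scale (c : R[i]) (x : bh) : exists g, is_adj (fun u => c *: x u) g.
Proof.
have [f hf] := bh_adj x.
by exists (fun u => Num.conj c *: f u) => u v; rewrite innerZl innerZr hf conjCK.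
Qed.
Definition bh_scale c x := Bh (bounded_scale c x) (adj_scale c x).

Fact bounded_opp (x : bh) : bounded_op (fun u => - x u).
Proof.
suff -> : (fun u => - x u) = (fun u => -1 *: x u) by exact: bounded_scale.
by apply: funext => u; rewrite scaleN1r.
Qed.
Fact adj_opp (x : bh) : exists g, is_adj (fun u => - x u) g.
Proof.
suff -> : (fun u => - x u) = (fun u => -1 *: x u) by exact: adj_scale.
by apply: funext => u; rewrite scaleN1r.
Qed.
Definition bh_opp x := Bh (bounded_opp x) (adj_opp x).

Fact bounded_mul (x y : bh) : bounded_op (fun u => x (y u)).
Proof.
apply/bounded_opP; split.
  by move=> c u v; rewrite !linearfD !linearfZ.
have [C C0 hC] := bh_bound x; have [D _ hD] := bh_bound y; exists (C * D) => u.
by apply: le_trans (hC _) _; rewrite -mulrA ler_wpM2l.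
Qed.
Fact adj_mul (x y : bh) : exists g, is_adj (fun u => x (y u)) g.
Proof.
have [f hf] := bh_adj x; have [g hg] := bh_adj y.
by exists (fun u => g (f u)) => u v; rewrite hf hg.
Qed.
Definition bh_mul x y := Bh (bounded_mul x y) (adj_mul x y).

Fact bh_addA : associative bh_add.
Proof. by move=> x y z; apply: bh_ext => u /=; rewrite addrA. Qed.
Fact bh_addC : commutative bh_add.
Proof. by move=> x y; apply: bh_ext => u /=; rewrite addrC. Qed.
Fact bh_add0 : left_id bh_zero bh_add.
Proof. by move=> x; apply: bh_ext => u /=; rewrite add0r. Qed.
Fact bh_addN : left_inverse bh_zero bh_opp bh_add.
Proof. by move=> x; apply: bh_ext => u /=; rewrite addNr. Qed.
HB.instance Definition _ := GRing.isZmodule.Build bh bh_addA bh_addC bh_add0 bh_addN.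

Fact bh_mulA : associative bh_mul.
Proof. by move=> x y z; apply: bh_ext. Qed.
Fact bh_mul1 : left_id bh_one bh_mul.
Proof. by move=> x; apply: bh_ext. Qed.
Fact bh_mulr1 : right_id bh_one bh_mul.
Proof. by move=> x; apply: bh_ext. Qed.
Fact bh_mulDl : left_distributive bh_mul bh_add.
Proof. by move=> x y z; apply: bh_ext. Qed.
Fact bh_mulDr : right_distributive bh_mul bh_add.
Proof. by move=> x y z; apply: bh_ext => u /=; rewrite linearfD. Qed.
(** A ring in which [1 = 0] is permitted, because [H] may be the zero space. *)
HB.instance Definition _ := GRing.Zmodule_isPzRing.Build bh
  bh_mulA bh_mul1 bh_mulr1 bh_mulDl bh_mulDr.

Fact bh_scaleA c d x : bh_scale c (bh_scale d x) = bh_scale (c * d) x.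
Proof. by apply: bh_ext => u /=; rewrite scalerA. Qed.
Fact bh_scale1 : left_id 1 bh_scale.
Proof. by move=> x; apply: bh_ext => u /=; rewrite scale1r. Qed.
Fact bh_scaleDr : right_distributive bh_scale +%R.
Proof. by move=> c x y; apply: bh_ext => u /=; rewrite scalerDr. Qed.
Fact bh_scaleDl x : {morph bh_scale^~ x : c d / c + d}.
Proof. by move=> c d; apply: bh_ext => u /=; rewrite scalerDl. Qed.
HB.instance Definition _ := GRing.Zmodule_isLmodule.Build R[i] bh
  bh_scaleA bh_scale1 bh_scaleDr bh_scaleDl.

Lemma bhD (x y : bh) u : (x + y) u = x u + y u. Proof. by []. Qed.
Lemma bhB (x y : bh) u : (x - y) u = x u - y u. Proof. by []. Qed.
Lemma bhM (x y : bh) u : (x * y) u = x (y u). Proof. by []. Qed.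
Lemma bhZ c (x : bh) u : (c *: x) u = c *: x u. Proof. by []. Qed.

Lemma bh_scalerAl (c : R[i]) (x y : bh) : c *: (x * y) = (c *: x) * y.
Proof. exact: bh_ext. Qed.
Lemma bh_scalerAr (c : R[i]) (x y : bh) : c *: (x * y) = x * (c *: y).
Proof. by apply: bh_ext => u /=; rewrite linearfZ. Qed.

Fact adj_bounded (x : bh) : bounded_op (adj x).
Proof.
have [g hg] := bh_adj x; rewrite (is_adj_adj hg).
exact: is_adj_bounded (bh_bounded x) hg.
Qed.
Lemma is_adjP (x : bh) : is_adj x (adj x).
Proof. by have [g hg] := bh_adj x; rewrite (is_adj_adj hg). Qed.
Fact adj_adjointable (x : bh) : exists g, is_adj (adj x) g.
Proof. by exists x; apply: is_adj_sym; exact: is_adjP. Qed.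
Definition star (x : bh) := Bh (adj_bounded x) (adj_adjointable x).

Lemma starP (x : bh) u v : inner (x u) v = inner u (star x v).
Proof. exact: is_adjP. Qed.
Lemma rdot_starr (x : bh) u v : rdot (x u) v = rdot u (star x v).
Proof. by rewrite /rdot starP. Qed.
Lemma is_adj_star (x y : bh) : is_adj x y -> star x = y.
Proof. by move=> /is_adj_adj h; apply: bh_ext => u /=; rewrite h. Qed.

Lemma starK x : star (star x) = x.
Proof. by apply: is_adj_star; apply: is_adj_sym => u v; rewrite starP. Qed.
Lemma rdot_starl (x : bh) u v : rdot (star x u) v = rdot u (x v).
Proof. by rewrite rdot_starr starK. Qed.
Lemma starD x y : star (x + y) = star x + star y.
Proof. by apply: is_adj_star => u v; rewrite innerDl innerDr !starP. Qed.
Lemma starM x y : star (x * y) = star y * star x.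
Proof.
by apply: is_adj_star => u v; rewrite bhM !starP.
Qed.
Lemma starZ c x : star (c *: x) = Num.conj c *: star x.
Proof. by apply: is_adj_star => u v; rewrite innerZl innerZr !starP conjCK. Qed.
Lemma starZr (t : R) x : star (t%:C *: x) = t%:C *: star x.
Proof. by rewrite starZ; rewrite (_ : Num.conj t%:C = t%:C) //; exact: conjc_real. Qed.
Lemma starN x : star (- x) = - star x.
Proof. by rewrite -scaleN1r starZ rmorphN1 scaleN1r. Qed.
Lemma starB x y : star (x - y) = star x - star y.
Proof. by rewrite starD starN. Qed.
Lemma star0 : star 0 = 0.
Proof. by apply: (addrI (star 0)); rewrite -starD !addr0. Qed.
Lemma star1 : star 1 = 1.
Proof. by apply: is_adj_star. Qed.

End BoundedOperators.
Arguments bh {R} H.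


(** * Operator bounds and positivity *)

Section OperatorOrder.
Context {R : realType} {H : hilbertType R}.
Implicit Types x y z : bh H.

Definition scc (l : R[i]) : bh H := l *: (1 : bh H).

Definition sca (t : R) : bh H := scc t%:C.

Lemma scc_mull l x : scc l * x = l *: x.
Proof. by apply: bh_ext. Qed.

Lemma scc_mulr l x : x * scc l = l *: x.
Proof. by apply: bh_ext => u; rewrite bhM bhZ linearfZ. Qed.

Lemma scaD s t : sca (s + t) = sca s + sca t.
Proof. by apply: bh_ext => u; rewrite bhD /= rmorphD scalerDl. Qed.

Lemma scaM s t : sca (s * t) = sca s * sca t.
Proof. by apply: bh_ext => u; rewrite bhM /= rmorphM scalerA. Qed.

Lemma sca1 : sca 1 = 1.
Proof. by apply: bh_ext => u; rewrite /= scale1r. Qed.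

Lemma scaN t : sca (- t) = - sca t.
Proof. by apply: bh_ext => u; rewrite /= rmorphN scaleNr. Qed.

Lemma scaE t u : sca t u = t%:C *: u. Proof. by []. Qed.

Lemma star_sca t : star (sca t) = sca t.
Proof. by rewrite starZr star1. Qed.

(** A bound on the operator norm, kept as a relation; a negative [C] is possible on the zero space
    only. *)
Definition opb (C : R) x := forall u, nrm (x u) <= C * nrm u.

Lemma opb_ex x : exists2 C, 0 <= C & opb C x.
Proof. exact: bh_bound. Qed.

Lemma opb_le C D x : C <= D -> opb C x -> opb D x.
Proof. by move=> CD h u; apply: le_trans (h u) _; rewrite ler_wpM2r ?nrm_ge0. Qed.

Lemma opb1 : opb 1 1.
Proof. by move=> u; rewrite mul1r. Qed.

Lemma opb0 : opb 0 0.
Proof. by move=> u; rewrite nrm0 mul0r. Qed.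

Lemma opbD C D x y : opb C x -> opb D y -> opb (C + D) (x + y).
Proof. by move=> hx hy u; rewrite mulrDl; apply: le_trans (nrmD _ _) _; apply: lerD. Qed.

Lemma opbN C x : opb C x -> opb C (- x).
Proof. by move=> hx u; rewrite nrmN. Qed.

Lemma opbB C D x y : opb C x -> opb D y -> opb (C + D) (x - y).
Proof. by move=> hx /opbN; apply: opbD. Qed.

Lemma opbM C D x y : 0 <= C -> opb C x -> opb D y -> opb (C * D) (x * y).
Proof.
move=> C0 hx hy u; apply: le_trans (hx _) _.
by rewrite -mulrA ler_wpM2l.
Qed.

Lemma opbZ C (t : R) x : opb C x -> opb (`|t| * C) (t%:C *: x).
Proof. by move=> h u; rewrite nrmZ -mulrA ler_wpM2l. Qed.

Lemma opb_rdot C x u v : opb C x -> `|rdot (x u) v| <= C * nrm u * nrm v.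
Proof.
move=> h; apply: le_trans (rdot_cauchy _ _) _.
by rewrite ler_wpM2r ?nrm_ge0.
Qed.

Lemma opb_of_rdot C x : 0 <= C ->
  (forall u v, rdot (x u) v <= C * nrm u * nrm v) -> opb C x.
Proof.
move=> C0 h u; have [->|n0] := eqVneq (nrm (x u)) 0.
  by rewrite mulr_ge0 ?nrm_ge0.
have n1 : 0 < nrm (x u) by rewrite lt_neqAle eq_sym n0 nrm_ge0.
by rewrite -(ler_pM2r n1) -expr2 nrm_sqr.
Qed.

Lemma opb_star C x : 0 <= C -> opb C x -> opb C (star x).
Proof.
move=> C0 h; apply: opb_of_rdot => // u v; rewrite rdot_starl rdotC.
by apply: le_trans (ler_norm _) _; rewrite mulrAC; apply: opb_rdot.
Qed.

Lemma opb_eq0 x : (forall e, 0 < e -> opb e x) -> x = 0.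
Proof.
move=> h; apply: bh_ext => u; apply: nrm_eq0; apply/eqP.
rewrite eq_le nrm_ge0 andbT; apply/ler_addgt0Pr => e e0; rewrite add0r.
have n1 : 0 < nrm u + 1 by rewrite ltr_wpDl ?nrm_ge0.
have := h (e / (nrm u + 1)) _ u; rewrite divr_gt0 // => /(_ isT) /le_trans; apply.
rewrite mulrAC ler_pdivrMr // ler_pM2l //; lra.
Qed.

Definition psd x := star x = x /\ forall u, 0 <= rdot (x u) u.

Lemma psd_sa x : psd x -> star x = x. Proof. by case. Qed.

Lemma psd1 : psd 1.
Proof. by split=> [|u]; rewrite ?star1 ?rdot_ge0. Qed.

Lemma psdD x y : psd x -> psd y -> psd (x + y).
Proof.
move=> [sx px] [sy py]; split=> [|u]; first by rewrite starD sx sy.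
by rewrite rdotDl addr_ge0.
Qed.

Lemma psdZ (t : R) x : 0 <= t -> psd x -> psd (t%:C *: x).
Proof.
move=> t0 [sx px]; split=> [|u]; first by rewrite starZr sx.
by rewrite rdotZl mulr_ge0.
Qed.

Lemma psd_conj x y : psd x -> psd (star y * x * y).
Proof.
move=> [sx px]; split=> [|u]; first by rewrite !starM starK sx mulrA.
by rewrite !bhM rdot_starl.
Qed.

Lemma psd_sqr x : psd (star x * x).
Proof. by have := psd_conj x psd1; rewrite mulr1. Qed.

Lemma star_sqr_eq0 x : star x * x = 0 -> x = 0.
Proof.
move=> h; apply: bh_ext => u; apply: nrm_eq0.
rewrite /nrm -rdot_starl -bhM h.
by rewrite /rdot inner0l sqrtr0.
Qed.

Lemma psd_opbr C x : psd x -> opb C x -> psd (sca C - x).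
Proof.
move=> [sx px] h; split=> [|u]; first by rewrite starB star_sca sx.
rewrite rdotBl rdotZl subr_ge0; apply: le_trans (ler_norm _) _.
by apply: le_trans (opb_rdot _ _ h) _; rewrite -mulrA -expr2 nrm_sqr.
Qed.

(* Cauchy-Schwarz for the form [<x u, v>], applied with [v = x u]. *)
Lemma opb_psd C x : psd x -> psd (sca C - x) -> opb C x.
Proof.
move=> [sx px] [_ pC].
have hC u : rdot (x u) u <= C * nrm u ^+ 2.
  by have := pC u; rewrite rdotBl rdotZl subr_ge0 nrm_sqr.
move=> u; set n := nrm (x u).
have hn : n ^+ 2 = rdot (x u) (x u) by rewrite nrm_sqr.
have cs : (n ^+ 2) ^+ 2 <= rdot (x u) u * rdot (x (x u)) (x u).
  rewrite hn; apply: (@psd_cauchy R H (fun u v => rdot (x u) v)) => t.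
  have := px (u + t%:C *: x u).
  rewrite linearfD linearfZ rdotDl !rdotDr !rdotZl !rdotZr.
  have -> : rdot (x (x u)) u = rdot (x u) (x u) by rewrite rdot_starr sx.
  by congr (_ <= _); ring.
have n0 : 0 <= n by exact: nrm_ge0.
have m0 : 0 <= nrm u by exact: nrm_ge0.
have h1 := hC u; have h2 := hC (x u); have p1 := px u; have p2 := px (x u).
rewrite -/n in h2.
have [n00|n1] := eqVneq n 0.
  rewrite n00; have [c0|c0] := leP 0 C; first by rewrite mulr_ge0.
  rewrite le_eqVlt; apply/orP; left; apply/eqP; nra.
have {n0}n0 : 0 < n by rewrite lt_neqAle eq_sym n1.
have [c0|c0] := leP 0 C; last first.
  have : C * n ^+ 2 < 0 by rewrite nmulr_rlt0 // exprn_gt0.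
  lra.
have : (n ^+ 2) ^+ 2 <= (C * nrm u ^+ 2) * (C * n ^+ 2).
  by apply: le_trans cs _; apply: ler_pM.
have -> : (n ^+ 2) ^+ 2 = n ^+ 2 * n ^+ 2 by ring.
have -> : (C * nrm u ^+ 2) * (C * n ^+ 2) = (C * nrm u) ^+ 2 * n ^+ 2 by ring.
rewrite ler_pM2r ?exprn_gt0 // ler_pXn2r ?nnegrE ?mulr_ge0 //; exact: ltW.
Qed.

Lemma psd_opb_sqr C x : 0 <= C -> opb C x -> psd (sca (C ^+ 2) - star x * x).
Proof.
move=> C0 h; apply: psd_opbr; first exact: psd_sqr.
by rewrite expr2; apply: opbM => //; exact: opb_star.
Qed.

Lemma opb_psd_sqr C x : 0 <= C -> psd (sca (C ^+ 2) - star x * x) -> opb C x.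
Proof.
move=> C0 [_ h] u; rewrite -(@ler_pXn2r _ 2) ?nnegrE ?mulr_ge0 ?nrm_ge0 //.
rewrite exprMn !nrm_sqr -rdot_starl.
by have := h u; rewrite rdotBl rdotZl subr_ge0.
Qed.

(** Polarization over the complex numbers: the form is real at [u + v] and at [u + 'i *: v], which
    gives the two components of the symmetry. In particular a positive map has an adjoint and can be
    bundled as a [bh]. *)
Lemma positive_op_sa (f : H -> H) : positive_op f -> is_adj f f.
Proof.
move=> [[lf _] pf].
have fD u v : f (u + v) = f u + f v by have := lf 1 u v; rewrite !scale1r.
have f0 : f 0 = 0 by apply: (addrI (f 0)); rewrite -fD !addr0.
have fZ c u : f (c *: u) = c *: f u by have := lf c u 0; rewrite f0 !addr0.
have im u : complex.Im (inner (f u) u) = 0 by apply: ger0_Im; exact: pf.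
move=> u v; apply/eqP; have h1 := im (u + v); have h2 := im (u + 'i *: v).
rewrite eq_complex (inner_conj u (f v)).
move: h1 h2; rewrite !fD !fZ !innerDl !innerDr !innerZl !innerZr.
have := im v; have := im u.
case: (inner (f u) u) => a1 a2 /= ->; case: (inner (f v) v) => b1 b2 /= ->.
case: (inner (f u) v) => c1 c2; case: (inner (f v) u) => d1 d2 /= h1 h2.
apply/andP; split; apply/eqP; lra.
Qed.

Lemma positive_opP x : positive_op x <-> psd x.
Proof.
split=> [px|[sx px]].
  split; first by apply: is_adj_star; exact: positive_op_sa.
  by case: px => _ px u; have := px u; rewrite lecE => /andP[].
split=> [|u]; first exact: bh_bounded.
rewrite lecE px andbT /=; apply/eqP.
have : inner (x u) u = Num.conj (inner (x u) u).
  by rewrite {1}starP sx inner_conj.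
by case: (inner _ _) => a b [] /=; lra.
Qed.

Lemma positive_op_bh (f : H -> H) : positive_op f ->
  exists2 x : bh H, bh_fun x = f & psd x.
Proof.
move=> pf; have [bf _] := pf.
have sf : exists g, is_adj f g by exists f; exact: positive_op_sa.
by exists (Bh bf sf) => //; apply/positive_opP.
Qed.

End OperatorOrder.


(** * Norm completeness and the Neumann series *)

Section Completeness.
Context {R : realType} {H : hilbertType R}.

Lemma hilbert_cauchy (w : nat -> H) :
  (forall e : R, 0 < e -> exists N, forall m n, (N <= m)%N -> (N <= n)%N -> nrm (w m - w n) <= e) ->
  exists l, forall e : R, 0 < e -> exists N, forall n, (N <= n)%N -> nrm (w n - l) <= e.
Proof.
move=> h.
have /cauchy_cvgP wl : cauchy (w @ \oo).
  apply: cauchy_exP => eps e0.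
  have re : eps \is Num.real by rewrite gtr0_real.
  have e0' : 0 < complex.Re eps.
    by rewrite -ltcR RRe_real.
  have [N hN] := h (complex.Re eps / 2) (divr_gt0 e0' (ltr0n _ 2)).
  exists (w N); exists N => // n /= Nn.
  rewrite -ball_normE /= normE -[eps](RRe_real re) ltcR.
  apply: le_lt_trans (hN _ _ (leqnn N) Nn) _.
  by rewrite ltr_pdivrMr // mulrDr mulr1 ltrDl.
exists (lim (w @ \oo)) => e e0.
have e0' : 0 < e%:C by rewrite ltcR.
have /cvgrPdist_le /(_ _ e0')[N _ hN] := wl.
exists N => n Nn; have := hN n Nn; rewrite /= normE lecR.
by rewrite nrmB.
Qed.

Lemma nrm_le_lim (w l : H) (C : R) :
  (forall e, 0 < e -> exists2 v, nrm (v - l) <= e & nrm (w - v) <= C + e) ->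
  nrm (w - l) <= C.
Proof.
move=> h; apply/ler_addgt0Pr => e e0.
have [v h1 h2] := h (e / 2) (divr_gt0 e0 (ltr0n _ 2)).
have := nrmD (w - v) (v - l); rewrite addrA subrK; lra.
Qed.

(** The limit has to come with an adjoint. The operators [star (x n)] are Cauchy with the same
    bounds, so they have a limit too, and the two pointwise limits turn out to be adjoint to each
    other. *)
Lemma opb_cauchy (x : nat -> bh H) :
  (forall e : R, 0 < e -> exists N, forall m n, (N <= m)%N -> (N <= n)%N -> opb e (x m - x n)) ->
  exists l, forall e : R, 0 < e -> exists N, forall n, (N <= n)%N -> opb e (x n - l).
Proof.
have step (y : nat -> bh H) :
  (forall e : R, 0 < e -> exists N, forall m n, (N <= m)%N -> (N <= n)%N -> opb e (y m - y n)) ->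
  exists f : H -> H, forall e : R, 0 < e -> exists N, forall n, (N <= n)%N ->
     forall u, nrm (y n u - f u) <= e * nrm u.
  move=> h.
  have /choice[f hf] u : exists l, forall e : R, 0 < e ->
      exists N, forall n, (N <= n)%N -> nrm (y n u - l) <= e.
    apply: hilbert_cauchy => e e0.
    have n1 : 0 < nrm u + 1 by rewrite ltr_wpDl ?nrm_ge0.
    have [N hN] := h (e / (nrm u + 1)) (divr_gt0 e0 n1).
    exists N => m n Nm Nn; apply: le_trans (hN m n Nm Nn u) _.
    rewrite mulrAC ler_pdivrMr // ler_pM2l //; lra.
  exists f => e e0; have [N hN] := h e e0; exists N => n Nn u.
  apply: nrm_le_lim => d d0; have [N' hN'] := hf u d d0.
  exists (y (maxn N N') u); first by apply: hN'; rewrite leq_maxr.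
  have := hN n (maxn N N') Nn (leq_maxl _ _) u; rewrite bhB.
  move=> /le_trans; apply; lra.
move=> h; have [f hf] := step _ h.
have hs : forall e : R, 0 < e -> exists N, forall m n, (N <= m)%N -> (N <= n)%N ->
    opb e (star (x m) - star (x n)).
  move=> e e0; have [N hN] := h e e0; exists N => m n Nm Nn.
  by rewrite -starB; apply: opb_star; [exact: ltW | exact: hN].
have [g hg] := step _ hs.
have adjfg : is_adj f g.
  move=> u v; apply: inner_rdot => c.
  apply/eqP; rewrite -subr_eq0 -normr_eq0; apply/eqP/le_anti/andP; split=> //.
  apply/ler_addgt0Pr => e e0; rewrite add0r.
  pose k := complex.Re `|c|.
  have k0 : 0 <= k by have := normr_ge0 c; rewrite lecE => /andP[].
  (* The two error terms add up to at most [e / K * (2 * k * nrm u * nrm v)]; the summand 1 keeps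
     [K] positive. *)
  pose K := 2 * k * nrm u * nrm v + 1.
  have K0 : 0 < K by rewrite ltr_wpDl // !mulr_ge0 ?nrm_ge0.
  have [N hN] := hf _ (divr_gt0 e0 K0); have [N' hN'] := hg _ (divr_gt0 e0 K0).
  have h1 := hN (maxn N N') (leq_maxl _ _) u.
  have h2 := hN' (maxn N N') (leq_maxr _ _) v.
  set n := maxn _ _ in h1 h2.
  have -> : rdot (f u) (c *: v) - rdot u (c *: g v) =
      rdot u (c *: (star (x n) v - g v)) - rdot (x n u - f u) (c *: v).
    by rewrite rdotBl scalerBr rdotBr -linearfZ -rdot_starr; ring.
  apply: le_trans (ler_normB _ _) _.
  have := rdot_cauchy u (c *: (star (x n) v - g v)).
  have := rdot_cauchy (x n u - f u) (c *: v).
  rewrite !nrmZi -/k => r1 r2.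
  have i1 : nrm u * (k * nrm (star (x n) v - g v)) <= nrm u * (k * (e / K * nrm v)).
    by rewrite ler_wpM2l ?nrm_ge0 // ler_wpM2l.
  have i2 : nrm (x n u - f u) * (k * nrm v) <= e / K * nrm u * (k * nrm v).
    by rewrite ler_wpM2r ?mulr_ge0 ?nrm_ge0.
  have : e / K * (2 * k * nrm u * nrm v) <= e.
    by rewrite mulrAC ler_pdivrMr // ler_pM2l // /K lerDl.
  lra.
have bf : bounded_op f.
  apply/bounded_opP; split; first exact: is_adj_linear (is_adj_sym adjfg).
  have [N hN] := hf 1 ltr01; have [C C0 hC] := opb_ex (x N).
  exists (1 + C) => u; have := hN N (leqnn N) u; have := hC u.
  have := nrmD (x N u) (f u - x N u); rewrite addrC subrK (nrmB (f u)); lra.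
exists (Bh bf (ex_intro _ g adjfg)) => e e0.
by have [N hN] := hf e e0; exists N.
Qed.

Definition invertible (x : bh H) := exists y : bh H, x * y = 1 /\ y * x = 1.

Lemma neumann (x : bh H) (C : R) : 0 <= C -> C < 1 -> opb C x -> invertible (1 - x).
Proof.
move=> C0 C1 hx.
pose s n : bh H := \sum_(i < n) x ^+ i.
have hxn n : opb (C ^+ n) (x ^+ n).
  elim: n => [|n IH]; first by rewrite !expr0; exact: opb1.
  by rewrite !exprS; exact: opbM.
have sl n : (1 - x) * s n = 1 - x ^+ n.
  elim: n => [|n IH]; first by rewrite /s big_ord0 mulr0 expr0 subrr.
  rewrite /s big_ord_recr /= mulrDr -/(s n) IH mulrBl mul1r -exprS.
  by rewrite addrA subrK.
have sc n : (1 - x) * s n = s n * (1 - x).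
  have cx : x * s n = s n * x.
    elim: n => [|n IH]; first by rewrite /s big_ord0 mulr0 mul0r.
    by rewrite /s big_ord_recr /= -/(s n) mulrDr mulrDl IH -exprS -exprSr.
  by rewrite mulrBl mulrBr mul1r mulr1 cx.
have C1' : 0 < 1 - C by lra.
have diff m n : (m <= n)%N -> opb (C ^+ m / (1 - C)) (s n - s m).
  move=> mn; apply: (@opb_le _ _ ((C ^+ m - C ^+ n) / (1 - C))).
    rewrite ler_pM2r ?invr_gt0 // gerBl exprn_ge0 //.
  rewrite -(subnK mn); elim: (n - m)%N => [|k IH].
    by rewrite add0n !subrr mul0r; exact: opb0.
  rewrite addSn /s big_ord_recr /= -/(s (k + m)) -/(s m) addrAC.
  have -> : (C ^+ m - C ^+ (k + m).+1) / (1 - C) = (C ^+ m - C ^+ (k + m)) / (1 - C) + C ^+ (k + m).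
    by rewrite exprS; field; lra.
  exact: opbD.
have small e : 0 < e -> exists N, forall m, (N <= m)%N -> C ^+ m / (1 - C) <= e.
  move=> e0; have aC : `|C| < 1 by rewrite ger0_norm.
  have /cvgrPdist_le/(_ _ (mulr_gt0 e0 C1'))[N _ hN] := cvg_expr aC.
  exists N => m Nm.
  rewrite ler_pdivrMr //; have := hN m Nm; rewrite /= sub0r normrN.
  by rewrite ger0_norm ?exprn_ge0.
have [y hy] : exists y, forall e : R, 0 < e -> exists N, forall n, (N <= n)%N -> opb e (s n - y).
  apply: opb_cauchy => e e0; have [N hN] := small e e0; exists N => m n Nm Nn.
  have [mn|nm] := leqP m n.
    by rewrite -opprB; apply/opbN/(opb_le (hN m Nm)); exact: diff.
  by apply: (opb_le (hN n Nn)); apply: diff; exact: ltnW.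
have [D D0 hD] := opb_ex (1 - x).
have key e : 0 < e -> exists n, opb e (x ^+ n) /\ opb e (s n - y).
  move=> e0; have [N hN] := hy e e0; have [N' hN'] := small (e / (1 - C)) (divr_gt0 e0 C1').
  exists (maxn N N'); split; last by apply: hN; rewrite leq_maxl.
  apply: opb_le (hxn _).
  have := hN' _ (leq_maxr N N'); by rewrite ler_pM2r ?invr_gt0.
(* The errors [x ^+ n] and [(1 - x) * (s n - y)] will contribute [e / (1 + D)] and
   [D * e / (1 + D)]. *)
have D1 : 0 < 1 + D by lra.
exists y; split; apply/eqP; rewrite -subr_eq0; apply/eqP/opb_eq0 => e e0;
  have [n [h1 h2]] := key _ (divr_gt0 e0 D1).
  have -> : (1 - x) * y - 1 = - (x ^+ n) - (1 - x) * (s n - y).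
    by rewrite mulrBr sl !opprB addrCA addKr.
  apply: opb_le (opbB (opbN h1) (opbM D0 hD h2)).
  by rewrite -[X in X + _]mul1r -mulrDl mulrC divfK //; lra.
have -> : y * (1 - x) - 1 = - (x ^+ n) - (s n - y) * (1 - x).
  by rewrite mulrBl -sc sl !opprB addrCA addKr.
have e1 : 0 <= e / (1 + D) by rewrite divr_ge0 // ltW.
apply: opb_le (opbB (opbN h1) (opbM e1 h2 hD)).
by rewrite -{1}[e / _]mulr1 -mulrDr divfK //; lra.
Qed.

End Completeness.


(** * Real spectrum, lower bounds and norms *)

Section Spectrum.
Context {R : realType} {H : hilbertType R}.
Implicit Types (x y : bh H) (P Q : {poly R[i]}).

(** Injectivity with closed range: the half of invertibility that can be read off from norms. *)
Definition bounded_below x := exists2 c : R, 0 < c & forall u, c * nrm u <= nrm (x u).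

Lemma bounded_belowM x y : bounded_below x -> bounded_below y -> bounded_below (x * y).
Proof.
move=> [c c0 hc] [d d0 hd]; exists (c * d); first exact: mulr_gt0.
move=> u; rewrite bhM; apply: le_trans (hc _); rewrite -mulrA ler_pM2l //.
Qed.

Lemma bounded_belowZ (k : R[i]) x : k != 0 -> bounded_below x -> bounded_below (k *: x).
Proof.
move=> k0 [c c0 hc]; have k1 : 0 < complex.Re `|k|.
  by move: k0; rewrite -normr_gt0 ltcE => /andP[].
exists (complex.Re `|k| * c); first exact: mulr_gt0.
by move=> u; rewrite bhZ nrmZi -mulrA ler_pM2l.
Qed.

Lemma bounded_below1 : bounded_below 1.
Proof. by exists 1 => // u; rewrite mul1r. Qed.

Lemma notin_spectrum_invertible x l : invertible (x - scc l) -> ~ spectrum x l.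
Proof.
move=> [y [xy yx]] h; apply: h; exists y; split; first exact: bh_bounded.
  by apply: funext => u; exact: (congr1 (fun z : bh H => z u) xy).
by apply: funext => u; exact: (congr1 (fun z : bh H => z u) yx).
Qed.

Lemma notin_spectrum_bounded_below x l : ~ spectrum x l -> bounded_below (x - scc l).
Proof.
move=> /contrapT[b [/bounded_opP[_ [C hC]] _ bx]].
exists (`|C| + 1)^-1; first by rewrite invr_gt0 ltr_wpDl.
move=> u; rewrite mulrC ler_pdivrMr ?ltr_wpDl //.
rewrite -{1}[u](_ : b ((x - scc l) u) = u); last by exact: (congr1 (fun f => f u) bx).
apply: le_trans (hC _) _; rewrite mulrC ler_wpM2l ?nrm_ge0 //.
by apply: le_trans (ler_norm _) _; rewrite lerDl.
Qed.

(** With [y = x - Re l] and [t = Im l], |(y - i t) u|^2 = |y u|^2 + t^2 |u|^2: the cross term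
    vanishes because [inner (y u) u] is real. *)
Lemma nonreal_bounded_below x l : star x = x -> complex.Im l != 0 -> bounded_below (x - scc l).
Proof.
case: l => s t /= sx t0; exists `|t|; first by rewrite normr_gt0.
move=> u; rewrite -(@ler_pXn2r _ 2) ?nnegrE ?mulr_ge0 ?nrm_ge0 //.
rewrite exprMn !nrm_sqr real_normK ?num_real //.
have -> : (x - scc (s +i* t)) u = (x - sca s) u - t%:C *: ('i *: u).
  rewrite !bhB bhZ scaE scalerA -addrA -opprD -scalerDl; congr (_ - _ *: _).
  by apply/eqP; rewrite eq_complex /=; apply/andP; split; apply/eqP; ring.
set y := x - sca s; have sy : star y = y by rewrite starB sx star_sca.
clearbody y.
have cross : rdot (y u) ('i *: u) = 0.
  have : rdot (y u) ('i *: u) = rdot u ('i *: y u) by rewrite rdot_starr sy linearfZ.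
  rewrite -!Im_inner [inner u _]inner_conj.
  by case: (inner (y u) u) => a b /=; lra.
have ii : rdot ('i *: u) ('i *: u) = rdot u u.
  by rewrite -!nrm_sqr nrmZi normc_def /= expr0n expr1n add0r sqrtr1 mul1r.
rewrite rdotBl !rdotBr !rdotZl !rdotZr cross (rdotC _ (y u)) cross ii.
by have := rdot_ge0 (y u); lra.
Qed.

(** Outside [0, K] a Neumann series inverts [x - t]. For [t > K] its ratio is K / t. For [t < 0] the
    expansion is in [K - x], which also has norm at most [K] since 0 <= K - x <= K, and the ratio is
    K / (K - t). *)
Lemma spectrum_itv x (K t : R) : 0 <= K -> psd x -> opb K x -> spectrum x t%:C -> 0 <= t <= K.
Proof.
move=> K0 px hx st; apply: contrapT => /negP; rewrite negb_and -!ltNge => ht.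
suff : invertible (x - scc t%:C) by move/notin_spectrum_invertible.
have invM (c : R) y : c != 0 -> invertible y -> invertible (sca c * y).
  move=> c0 [z [yz zy]]; exists (sca c^-1 * z).
  rewrite !scc_mull -!bh_scalerAl -!bh_scalerAr !scalerA yz zy.
  by split; rewrite -rmorphM /= ?divff ?mulVf // scale1r.
have [t0|t0] := ltP t 0.
  have Kt : 0 < K - t by lra.
  have -> : x - scc t%:C = sca (K - t) * (1 - sca (K - t)^-1 * (sca K - x)).
    rewrite mulrBr mulr1 mulrA -scaM divff ?gt_eqF // sca1 mul1r.
    by rewrite opprB scaD scaN [RHS]addrC addrA subrK.
  apply: invM; first by rewrite gt_eqF.
  apply: (@neumann _ _ _ ((K - t)^-1 * K)); first by rewrite mulr_ge0 // invr_ge0 ltW.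
    by rewrite mulrC ltr_pdivrMr // mul1r; lra.
  rewrite scc_mull -[X in X * _]ger0_norm ?invr_ge0 1?ltW //; apply: opbZ.
  apply: opb_psd; first exact: psd_opbr.
  by rewrite opprB addrC subrK.
have tK : K < t by move: ht; rewrite ltNge t0 /=.
have t1 : 0 < t by lra.
have -> : x - scc t%:C = sca (- t) * (1 - sca t^-1 * x).
  by rewrite mulrBr mulr1 mulrA -scaM mulNr divff ?gt_eqF // !scaN sca1 mulN1r opprK addrC.
apply: invM; first by rewrite oppr_eq0 gt_eqF.
apply: (@neumann _ _ _ (t^-1 * K)); first by rewrite mulr_ge0 // invr_ge0 ltW.
  by rewrite mulrC ltr_pdivrMr // mul1r.
by rewrite scc_mull -[X in X * _]ger0_norm ?invr_ge0 1?ltW //; apply: opbZ.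
Qed.

(** The least bound [t0] of a positive operator is an approximate eigenvalue: if [t0 > tau], the
    positive operator [t0 - s] is bounded below, hence at least some [d > 0], and [t0 - d] is a
    smaller bound. *)
Lemma opb_of_bounded_below s (tau : R) : psd s -> 0 <= tau ->
  (forall t, tau < t -> bounded_below (sca t - s)) -> opb tau s.
Proof.
move=> ps tau0 hb.
pose A := [set t : R | 0 <= t /\ opb t s].
have [C C0 hC] := opb_ex s.
have Ane : A !=set0 by exists C.
have Alb : lbound A 0 by move=> t [].
have hA : has_inf A by split=> //; exists 0.
pose t0 := inf A.
have t00 : 0 <= t0 by apply: lb_le_inf.
have ht0 : opb t0 s.
  move=> u; apply/ler_addgt0Pr => e e0.
  have n1 : 0 < nrm u + 1 by rewrite ltr_wpDl ?nrm_ge0.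
  have [t [_ ht] tt] := inf_adherent (divr_gt0 e0 n1) hA.
  apply: le_trans (ht u) _; apply: (@le_trans _ _ ((t0 + e / (nrm u + 1)) * nrm u)).
    by rewrite ler_wpM2r ?nrm_ge0 // ltW.
  rewrite mulrDl lerD2l mulrAC ler_pdivrMr // ler_pM2l //; lra.
have [tt|tt] := leP t0 tau; first exact: opb_le tt ht0.
have [c c0 hc] := hb _ tt.
have py := psd_opbr ps ht0; set y := sca t0 - s in py hc.
have ey : y = sca t0 - s by []; clearbody y.
have [D D0 hD] := opb_ex y.
(* Cauchy-Schwarz for the form of [y] will give |y u|^2 <= (D + 1) <y u, u>, so [y] is at least
   [c ^+ 2 / (D + 1)]. The minimum keeps [t0 - d] nonnegative, as membership in [A] requires. *)
pose d := Num.min t0 (c ^+ 2 / (D + 1)).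
have D1 : 0 < D + 1 by lra.
have d0 : 0 < d by rewrite lt_min (le_lt_trans tau0 tt) divr_gt0 ?exprn_gt0.
have dt : d <= t0 by rewrite ge_min lexx.
suff : t0 <= t0 - d by lra.
apply: ge_inf; first by exists 0.
split; first by lra.
apply: (opb_psd ps).
split=> [|u]; first by rewrite starB star_sca (psd_sa ps).
have -> : sca (t0 - d) - s = y - sca d by rewrite ey scaD (scaN d) addrAC.
rewrite rdotBl rdotZl subr_ge0.
have cs : rdot (y u) (y u) ^+ 2 <= rdot (y u) u * rdot (y (y u)) (y u).
  apply: (@psd_cauchy R H (fun u v => rdot (y u) v)) => t.
  have := (proj2 py) (u + t%:C *: y u).
  rewrite linearfD linearfZ rdotDl !rdotDr !rdotZl !rdotZr.
  have -> : rdot (y (y u)) u = rdot (y u) (y u) by rewrite rdot_starr psd_sa.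
  by congr (_ <= _); ring.
have dc : d * (D + 1) <= c ^+ 2 by rewrite -ler_pdivlMr // ge_min lexx orbT.
have n0 := nrm_ge0 u; have m0 := nrm_ge0 (y u).
have hy : rdot (y (y u)) (y u) <= (D + 1) * rdot (y u) (y u).
  apply: le_trans (ler_norm _) _; apply: le_trans (opb_rdot _ _ hD) _.
  by rewrite -mulrA -expr2 nrm_sqr; have := rdot_ge0 (y u); nra.
have hcu : c ^+ 2 * rdot u u <= rdot (y u) (y u).
  by rewrite -!nrm_sqr -exprMn ler_pXn2r ?nnegrE ?mulr_ge0 ?(ltW c0).
have pyu := (proj2 py) u.
have [z|nz] := eqVneq (rdot (y u) (y u)) 0.
  have : 0 < c ^+ 2 by rewrite exprn_gt0.
  by have := rdot_ge0 u; nra.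
have rp : 0 < rdot (y u) (y u) by rewrite lt_neqAle eq_sym nz rdot_ge0.
have h1 : rdot (y u) (y u) <= rdot (y u) u * (D + 1).
  rewrite -(ler_pM2r rp) -expr2; apply: le_trans cs _.
  by rewrite -mulrA ler_wpM2l.
rewrite -(ler_pM2r D1); apply: le_trans _ h1; apply: le_trans _ hcu.
by rewrite mulrAC ler_wpM2r ?rdot_ge0.
Qed.

(** For [t > 0] the operator t - x^2 is the negative of the product of x - sqrt t and x + sqrt t,
    hence bounded below. So x^2 = 0 and x = 0, and 0 is bounded below on the zero space only. That
    space, whose spectra are empty, accounts for the form of the conclusion. *)
Lemma spectrum_nonempty x : star x = x -> (forall t : R, ~ spectrum x t%:C) ->
  forall u : H, u = 0.
Proof.
move=> sx h u.
have bb t : bounded_below (x - sca t) by exact: notin_spectrum_bounded_below.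
have h0 : opb 0 (star x * x).
  apply: opb_of_bounded_below => // [|t t0]; first exact: psd_sqr.
  have -> : sca t - star x * x = scc (-1) * ((x - sca (Num.sqrt t)) * (x - sca (- Num.sqrt t))).
    rewrite sx scaN opprK scc_mull scaleN1r mulrBl !mulrDr.
    rewrite -scaM -(expr2 (Num.sqrt _)) sqr_sqrtr 1?ltW //.
    by rewrite scc_mulr scc_mull opprB (addrC (x * x)) opprD addrACA subrr add0r.
  by rewrite scc_mull; apply: bounded_belowZ; [rewrite oppr_eq0 oner_eq0 | apply: bounded_belowM].
have x0 : x = 0.
  apply: star_sqr_eq0; apply: bh_ext => v; apply: nrm_eq0; apply/eqP.
  by have := h0 v; rewrite mul0r eq_le nrm_ge0 andbT.
have [c c0 hc] := bb 0; apply: nrm_eq0; apply/eqP; rewrite eq_le nrm_ge0 andbT.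
have := hc u; rewrite x0 bhB scaE scale0r subr0 nrm0.
by rewrite pmulr_rle0.
Qed.

End Spectrum.


(** * Polynomials of an operator *)

Section PolynomialCalculus.
Context {R : realType} {H : hilbertType R}.
Implicit Types (x y : bh H) (P Q : {poly R[i]}).

(** The coefficients are complex so that [P] splits into linear factors. *)
Definition cpoly P x : bh H := \sum_(i < size P) P`_i *: x ^+ i.

Lemma cpolyE n P x : (size P <= n)%N -> cpoly P x = \sum_(i < n) P`_i *: x ^+ i.
Proof.
move=> sn; rewrite /cpoly -!(big_mkord xpredT (fun i => P`_i *: x ^+ i)).
rewrite (big_cat_nat (leq0n _) sn) /= [X in _ + X]big1_seq ?addr0 // => i.
by rewrite mem_index_iota => /andP[_ /andP[h _]]; rewrite nth_default ?scale0r.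
Qed.

Lemma cpolyC l x : cpoly l%:P x = scc l.
Proof. by rewrite (@cpolyE 1) ?size_polyC ?leq_b1 // big_ord1 coefC eqxx expr0. Qed.

Lemma cpolyD P Q x : cpoly (P + Q) x = cpoly P x + cpoly Q x.
Proof.
pose n := maxn (size P) (size Q).
rewrite !(@cpolyE n) ?leq_maxl ?leq_maxr ?size_polyD // -big_split.
by apply: eq_bigr => i _; rewrite coefD scalerDl.
Qed.

Lemma cpolyZ l P x : cpoly (l *: P) x = l *: cpoly P x.
Proof.
rewrite !(@cpolyE (size P)) ?size_scale_leq // scaler_sumr.
by apply: eq_bigr => i _; rewrite coefZ scalerA.
Qed.

Lemma cpolyMX P x : cpoly (P * 'X) x = cpoly P x * x.
Proof.
rewrite (@cpolyE (size P).+1); last first.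
  by apply: leq_trans (size_polyMleq _ _) _; rewrite size_polyX addn2.
rewrite big_ord_recl coefMX eqxx scale0r add0r /cpoly mulr_suml.
by apply: eq_bigr => i _; rewrite coefMX /= -bh_scalerAl -exprSr.
Qed.

Lemma cpolyM P Q x : cpoly (P * Q) x = cpoly P x * cpoly Q x.
Proof.
elim/poly_ind: Q => [|Q c IH].
  by rewrite mulr0 -[0]/(0%:P) cpolyC /scc scale0r mulr0.
rewrite mulrDr mulrA !cpolyD !cpolyMX IH cpolyC mulrDr mulrA; congr (_ + _).
by rewrite mulrC mul_polyC cpolyZ scc_mulr.
Qed.

Lemma cpolyXsubC l x : cpoly ('X - l%:P) x = x - scc l.
Proof.
rewrite cpolyD -polyCN cpolyC -[X in cpoly X]mul1r cpolyMX -[1]/(1%:P) cpolyC.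
by rewrite /scc scale1r mul1r scaleNr.
Qed.

Lemma cpoly_bounded_below P x : P != 0 ->
  (forall l, root P l -> bounded_below (x - scc l)) -> bounded_below (cpoly P x).
Proof.
move=> P0; have [r Pr] := closed_field_poly_normal P.
have lP : lead_coef P != 0 by rewrite lead_coef_eq0.
have rP l : root P l = (l \in r).
  by rewrite Pr rootZ // root_prod_XsubC.
move=> h; rewrite Pr cpolyZ; apply: bounded_belowZ => //.
have {}h l : l \in r -> bounded_below (x - scc l) by rewrite -rP; exact: h.
elim: r h {Pr rP} => [|l r IH] h.
  by rewrite big_nil -[1]/(1%:P) cpolyC /scc scale1r; exact: bounded_below1.
rewrite big_cons cpolyM cpolyXsubC; apply: bounded_belowM.
  by apply: h; rewrite inE eqxx.
by apply: IH => k kr; apply: h; rewrite inE kr orbT.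
Qed.

Definition rpoly (P : {poly R}) x : bh H := \sum_(i < size P) (P`_i)%:C *: x ^+ i.

Lemma rpolyE (P : {poly R}) x : rpoly P x = cpoly (map_poly (real_complex R) P) x.
Proof.
by rewrite /rpoly /cpoly size_map_poly; apply: eq_bigr => i _; rewrite coef_map.
Qed.

Lemma op_polyE (P : {poly R}) x : op_poly P x = rpoly P x.
Proof.
rewrite /op_poly /rpoly; elim/big_ind2: _ => // [f y g z -> -> //|i _].
apply: funext => u; rewrite bhZ; congr (_ *: _).
elim: (nat_of_ord i) u => [|n IH] u; first by rewrite expr0.
by rewrite exprS bhM -IH.
Qed.

Lemma rpolyD (P Q : {poly R}) x : rpoly (P + Q) x = rpoly P x + rpoly Q x.
Proof. by rewrite !rpolyE rmorphD cpolyD. Qed.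
Lemma rpolyM (P Q : {poly R}) x : rpoly (P * Q) x = rpoly P x * rpoly Q x.
Proof. by rewrite !rpolyE rmorphM cpolyM. Qed.
Lemma rpolyC c x : rpoly c%:P x = sca c.
Proof. by rewrite !rpolyE map_polyC cpolyC. Qed.
Lemma rpolyN (P : {poly R}) x : rpoly (- P) x = - rpoly P x.
Proof. by rewrite -mulN1r -polyCN rpolyM rpolyC scaN sca1 mulN1r. Qed.
Lemma rpolyB (P Q : {poly R}) x : rpoly (P - Q) x = rpoly P x - rpoly Q x.
Proof. by rewrite rpolyD rpolyN. Qed.
Lemma rpolyX x : rpoly 'X x = x.
Proof.
by rewrite rpolyE map_polyX -['X]subr0 cpolyXsubC /scc scale0r subr0.
Qed.

Lemma star_rpoly (P : {poly R}) x : star x = x -> star (rpoly P x) = rpoly P x.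
Proof.
move=> sx; rewrite /rpoly; elim/big_rec: _ => [|i y _ IH]; first by rewrite star0.
rewrite starD IH starZr; congr (_ *: _ + _).
elim: (nat_of_ord i) => [|n IHn]; first by rewrite expr0 star1.
by rewrite exprS starM IHn sx -exprS -exprSr.
Qed.

(** Here [y] is a bare linear map, since elements of a commutant come without an adjoint. *)
Lemma commutes_rpoly (P : {poly R}) x (y : H -> H) :
  linear y -> (forall u, y (x u) = x (y u)) -> forall u, y (rpoly P x u) = rpoly P x (y u).
Proof.
move=> ly yx.
have yD u v : y (u + v) = y u + y v by have := ly 1 u v; rewrite !scale1r.
have y0 : y 0 = 0 by apply: (addrI (y 0)); rewrite -yD !addr0.
have yZ c u : y (c *: u) = c *: y u by have := ly c u 0; rewrite y0 !addr0.
rewrite /rpoly; elim/big_rec: _ => [u|i z _ IH u]; first exact: y0.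
rewrite !bhD yD IH; congr (_ + _); rewrite !bhZ yZ; congr (_ *: _).
elim: (nat_of_ord i) u => [|n IHn] u; first by rewrite expr0.
by rewrite exprSr !bhM IHn yx.
Qed.

(* For [t > e ^ 2] no root of [t - P ^ 2] lies in the spectrum, so factoring this polynomial over
   the complex numbers shows that [t - P(x) ^ 2] is bounded below. *)
Lemma opb_rpoly (P : {poly R}) x (e : R) : star x = x -> 0 <= e ->
  (forall t : R, spectrum x t%:C -> `|P.[t]| <= e) -> opb e (rpoly P x).
Proof.
move=> sx e0 h; set y := rpoly P x; have sy : star y = y by apply: star_rpoly.
suff : opb (e ^+ 2) (star y * y).
  move=> /(psd_opbr (psd_sqr y)); exact: opb_psd_sqr.
apply: opb_of_bounded_below => [||t et]; [exact: psd_sqr|exact: sqr_ge0|].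
pose Q := t%:P - P * P.
have -> : sca t - star y * y = rpoly Q x by rewrite rpolyB rpolyC rpolyM sy.
have Qt s : spectrum x s%:C -> Q.[s] != 0.
  move=> /h; rewrite /Q !hornerE => Pe; apply/negP => /eqP.
  move/eqP; rewrite subr_eq0 -expr2 => /eqP Pt.
  have := lt_le_trans et (_ : t <= e ^+ 2); rewrite ltxx => /(_ _)/negP; apply => //.
  by rewrite Pt -real_normK ?num_real // ler_pXn2r ?nnegrE.
(* [Q] is zero if [P] is a constant with square [t]. As [Q] has no root in the spectrum, the
   spectrum is then empty and [H] is the zero space. *)
have [Q0|Q0] := eqVneq Q 0.
  have z := @spectrum_nonempty _ _ x sx.
  exists 1 => // u; rewrite (z _ u) ?linearf0 ?nrm0 ?mulr0 // => s /Qt.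
  by rewrite Q0 horner0 eqxx.
rewrite rpolyE; apply: cpoly_bounded_below; first by rewrite map_poly_eq0.
move=> l rl; have [il|il] := eqVneq (complex.Im l) 0; last exact: nonreal_bounded_below.
apply: notin_spectrum_bounded_below.
have el : l = (complex.Re l)%:C by case: l il {rl} => ? ? /= ->.
rewrite el => /Qt/negP; apply.
by move: rl; rewrite {1}el /root horner_map fmorph_eq0.
Qed.

End PolynomialCalculus.


(** * Weierstrass approximation by Bernstein polynomials *)

Section Weierstrass.
Context {R : realType}.

(* [bernstein n f] is the Bernstein polynomial
   [\sum_k f k 'C(n, k) 'X^k (1 - 'X)^(n - k)], in de Casteljau's recursive form. *)
Fixpoint bernstein (n : nat) (f : nat -> R) : {poly R} :=
  if n is m.+1 then (1 - 'X) * bernstein m f + 'X * bernstein m (fun k => f k.+1)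
  else (f 0%N)%:P.

(** The factor of [C] in the conclusion is the second moment about [d] of the binomial law with
    parameters [n] and [x]: variance plus squared bias. The centre [d] is free because the shifted
    sequence in the recursion needs [d - 1]. *)
Lemma bernstein_dist n (f : nat -> R) (x c d e C : R) : 0 <= x <= 1 ->
  (forall k, (k <= n)%N -> `|f k - c| <= e + C * (k%:R - d) ^+ 2) ->
  `|(bernstein n f).[x] - c| <= e + C * (n%:R * x * (1 - x) + (n%:R * x - d) ^+ 2).
Proof.
move=> /andP[x0 x1]; elim: n f d => [|n IH] f d h.
  have := h 0%N (leqnn _); rewrite /= hornerC => /le_trans; apply.
  by rewrite le_eqVlt; apply/orP; left; apply/eqP; ring.
have h0 := IH f d (fun k kn => h k (leqW kn)).
have h1 := IH (fun k => f k.+1) (d - 1).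
have {}h1 : `|(bernstein n (fun k => f k.+1)).[x] - c| <=
    e + C * (n%:R * x * (1 - x) + (n%:R * x - (d - 1)) ^+ 2).
  apply: h1 => k kn; apply: le_trans (h k.+1 kn) _.
  by rewrite -natr1 le_eqVlt; apply/orP; left; apply/eqP; ring.
rewrite /= !hornerE /=.
set a := (bernstein n f).[x] in h0 *; set b := (bernstein n _).[x] in h1 *.
have -> : (1 - x) * a + x * b - c = (1 - x) * (a - c) + x * (b - c) by ring.
apply: le_trans (ler_normD _ _) _.
rewrite !normrM (ger0_norm x0) [`|1 - x|]ger0_norm ?subr_ge0 //.
have x1' : 0 <= 1 - x by lra.
apply: le_trans (lerD (ler_wpM2l x1' h0) (ler_wpM2l x0 h1)) _.
by rewrite -natr1 le_eqVlt; apply/orP; left; apply/eqP; ring.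
Qed.


Lemma uniformly_continuous_segment (F : R -> R) (K e : R) : continuous F -> 0 < e ->
  exists2 d : R, 0 < d & forall x y, 0 <= x <= K -> `|x - y| < d -> `|F x - F y| <= e.
Proof.
move=> cF e0.
have := @segment_compact R 0 K.
move=> /compact_near_coveringP nc.
pose P (d : R) (x : R) := forall y, `|x - y| < d -> `|F x - F y| <= e.
have := nc R (0^'+ : set_system R) P _.
have h : forall x : R, `[0, K]%classic x -> \forall x' \near x & i \near 0^'+, P i x'.
  move=> x _.
  have /cvgrPdist_le/(_ _ (divr_gt0 e0 (ltr0n R 2)))[d /= d0 hd] := cF x.
  have d2 : 0 < d / 2 by rewrite divr_gt0.
  exists (ball x (d / 2), [set r | r < d / 2]) => /=.
    split; first exact: nbhsx_ballx.
    exact: nbhs_right_lt.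
  move=> -[x' i] /= [bx id] y xy.
  rewrite -ball_normE /= in bx.
  have e1 : `|F x - F x'| <= e / 2 by apply: hd; apply: lt_trans bx _; rewrite [ltRHS]splitr ltrDl.
  have e2 : `|F x - F y| <= e / 2.
    apply: hd; apply: le_lt_trans (ler_distD x' x y) _.
    rewrite [d]splitr; apply: ltrD bx _; exact: lt_trans xy id.
  have := ler_distD (F x) (F x') (F y); rewrite (distrC (F x') (F x)); lra.
(* [hd] covers the radii strictly between 0 and [d], hence the half. *)
move=> /(_ _ h)[d /= d0 hd]; exists (d / 2); first by rewrite divr_gt0.
move=> x y xK; apply: hd => //=; rewrite ?in_itv //= ?sub0r ?normrN ?gtr0_norm ?divr_gt0 //.
by rewrite ltr_pdivrMr //; lra.
Qed.

Lemma weierstrass (F : R -> R) (K e : R) : continuous F -> 0 < K -> 0 < e ->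
  exists P : {poly R}, forall t, 0 <= t <= K -> `|P.[t] - F t| <= e.
Proof.
move=> cF K0 e0.
have [d d0 hd] := uniformly_continuous_segment K cF (divr_gt0 e0 (ltr0n R 2)).
have [c _ hc] : exists2 c, c \in `[0, K]%R & forall t, t \in `[0, K]%R -> `|F t| <= `|F c|.
  apply: EVT_max; first exact: ltW.
  apply: continuous_subspaceT => x; apply: continuous_comp; first exact: cF.
  exact: norm_continuous.
set M := `|F c| in hc.
have M0 : 0 <= M by rewrite normr_ge0.
(* Chebyshev's argument. With m = n.+1, y = K k / m and t = K x, the oscillation 2 M is at most 2 M
   ((y - t) / d)^2 as soon as |y - t| >= d, and this square equals C / m^2 times (k - m x)^2. *)
pose C := 2 * M * K ^+ 2 / d ^+ 2.
have C0 : 0 <= C by rewrite /C divr_ge0 ?sqr_ge0 // mulr_ge0 ?sqr_ge0 // mulr_ge0.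
have [n hn] : exists n : nat, C / n.+1%:R <= e / 2.
  have C2 : 0 <= 2 * C / e by apply: divr_ge0; [exact: mulr_ge0|exact: ltW].
  exists (Num.bound (2 * C / e)); rewrite ler_pdivrMr //.
  have := archi_boundP C2; rewrite ltr_pdivrMr // -[(Num.bound _).+1%:R]natr1; lra.
pose f k := F (K * (k%:R / n.+1%:R)).
exists (bernstein n.+1 f \Po (K^-1 *: 'X)) => t /andP[t0 tK].
rewrite horner_comp hornerZ hornerX; set x := K^-1 * t.
have Kx : K * x = t by rewrite /x mulrA divff ?gt_eqF // mul1r.
have x01 : 0 <= x <= 1.
  by rewrite mulr_ge0 ?invr_ge0 ?(ltW K0) //= /x mulrC ler_pdivrMr // mul1r.
have /andP[x0 x1] := x01.
have n0 : 0 < n.+1%:R :> R by rewrite ltr0n.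
(* Centring at the mean [n.+1%:R * x] leaves only the variance. *)
have := @bernstein_dist n.+1 f x (F t) (n.+1%:R * x) (e / 2) (C / n.+1%:R ^+ 2) x01.
move=> /(_ _)/le_trans; apply; last first.
  rewrite subrr expr0n addr0.
  have -> : C / n.+1%:R ^+ 2 * (n.+1%:R * x * (1 - x)) = C / n.+1%:R * (x * (1 - x)).
    by field; rewrite addrC natr1 pnatr_eq0.
  have h1 : C / n.+1%:R * (x * (1 - x)) <= C / n.+1%:R * 1.
    by rewrite ler_wpM2l ?divr_ge0 //; nra.
  rewrite [leRHS]splitr lerD2l; apply: le_trans h1 _; rewrite mulr1; exact: hn.
move=> k kn; rewrite /f; set y := K * (k%:R / n.+1%:R).
have yK : 0 <= y <= K.
  rewrite mulr_ge0 ?(ltW K0) //= /y -[leRHS]mulr1 ler_pM2l // ler_pdivrMr // mul1r.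
  by rewrite ler_nat.
have tKK : 0 <= t <= K by rewrite t0.
have eC : C / n.+1%:R ^+ 2 * (k%:R - n.+1%:R * x) ^+ 2 = 2 * M * ((y - t) / d) ^+ 2.
  rewrite -Kx /C /y; field.
  by rewrite (gt_eqF d0) addrC natr1 pnatr_eq0.
rewrite eC; have [near|far] := ltP `|y - t| d.
  have := hd _ _ yK near; have : 0 <= 2 * M * ((y - t) / d) ^+ 2.
    by rewrite mulr_ge0 ?sqr_ge0 // mulr_ge0.
  lra.
have hM : `|F y - F t| <= 2 * M.
  have := ler_normB (F y) (F t); have := hc y; have := hc t.
  by rewrite !in_itv /= yK tKK => /(_ isT) ? /(_ isT); lra.
have : 1 <= ((y - t) / d) ^+ 2.
  rewrite -[X in _ <= X ^+ 2]/( _ / _) -real_normK ?num_real // exprn_ege1 //.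
  by rewrite normrM normfV (gtr0_norm d0) ler_pdivlMr // mul1r.
nra.
Qed.

End Weierstrass.


(** * Continuous functions on the half-line *)

Section ContinuousFunctions.
Context {R : realType}.
Implicit Types f g : R -> R.

(* Continuity on [0, +oo) only: [powR] takes the junk value 1 at negative arguments. *)
Definition cts f := exists2 F : R -> R, continuous F & forall t, 0 <= t -> F t = f t.

Lemma cts_continuous f : continuous f -> cts f.
Proof. by exists f. Qed.

Lemma cts_cst (c : R) : cts (fun=> c).
Proof. by apply: cts_continuous; exact: cst_continuous. Qed.

Lemma cts_id : cts id.
Proof. by apply: cts_continuous => t; exact: cvg_id. Qed.

Lemma cts_ext f g : (forall t, 0 <= t -> f t = g t) -> cts f -> cts g.
Proof. by move=> fg [F cF Ff]; exists F => // t t0; rewrite Ff ?fg. Qed.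

Lemma ctsD f g : cts f -> cts g -> cts (fun t => f t + g t).
Proof.
move=> [F cF Ff] [G cG Gg]; exists (F \+ G) => [t|t t0 /=]; last by rewrite Ff ?Gg.
by apply: continuousD; [exact: cF|exact: cG].
Qed.

Lemma ctsN f : cts f -> cts (fun t => - f t).
Proof.
move=> [F cF Ff]; exists (fun t => - F t) => [t|t t0 /=]; last by rewrite Ff.
by apply: continuousN; exact: cF.
Qed.

Lemma ctsB f g : cts f -> cts g -> cts (fun t => f t - g t).
Proof. by move=> cf /ctsN; exact: ctsD. Qed.

Lemma ctsM f g : cts f -> cts g -> cts (fun t => f t * g t).
Proof.
move=> [F cF Ff] [G cG Gg]; exists (F \* G) => [t|t t0 /=]; last by rewrite Ff ?Gg.
by apply: continuousM; [exact: cF|exact: cG].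
Qed.

Lemma cts_comp f g : (forall t, 0 <= t -> 0 <= f t) -> cts f -> cts g ->
  cts (fun t => g (f t)).
Proof.
move=> f0 [F cF Ff] [G cG Gg]; exists (fun t => G (F t)) => [t|t t0 /=].
  by apply: continuous_comp; [exact: cF|exact: cG].
by rewrite Ff // Gg // f0.
Qed.

Lemma cts_sqrt : cts Num.sqrt.
Proof. by apply: cts_continuous; exact: sqrt_continuous. Qed.

Lemma cts_inv_addn (e : R) : 0 < e -> cts (fun t => (t + e)^-1).
Proof.
move=> e0; exists (fun t => (`|t| + e)^-1) => [t|t t0]; last by rewrite ger0_norm.
apply: (@continuousV _ _ (fun t => `|t| + e)); first by rewrite gt_eqF // ltr_wpDl.
apply: continuousD; last exact: cst_continuous.
exact: norm_continuous.
Qed.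

(** For [r > 0] extension by 0 to the negative half-line is continuous; at 0, [s < e ^ (1/r)] gives
    [s ^ r <= e]. For [r = 0] the power is 1 even at 0, and the constant is the extension. *)
Lemma cts_powR (r : R) : 0 <= r -> cts (fun t => t `^ r).
Proof.
rewrite le_eqVlt => /orP[/eqP <-|r0].
  by apply: cts_ext (cts_cst 1) => t _; rewrite powRr0.
exists (fun t => if 0 < t then t `^ r else 0); last first.
  move=> t; rewrite le_eqVlt => /orP[/eqP <-|->//].
  by rewrite ltxx powR0 // gt_eqF.
move=> t; have [t0|t0|->] := ltgtP t 0.
- rewrite /continuous_at (lt_gtF t0).
  apply: (@cvg_trans _ ((fun=> 0 : R) @ t)); last exact: (@cst_continuous R R 0 t).
  apply: near_eq_cvg; near=> s.
  by rewrite lt_gtF //; near: s; exact: lt_nbhsl.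
- rewrite /continuous_at t0; apply: (@cvg_trans _ ((fun s => s `^ r) @ t)).
    apply: near_eq_cvg; near=> s.
    by rewrite ifT //; near: s; exact: lt_nbhsr.
  have : {for t, continuous (fun s : R => s `^ r)}.
    apply: differentiable_continuous; apply/derivable1_diffP.
    by apply: derivable_powR; rewrite in_itv /= t0.
  exact.
rewrite /continuous_at ltxx; apply/cvgrPdist_le => e e0.
near=> s; rewrite sub0r normrN; case: ifPn => s0; last by rewrite normr0 ltW.
rewrite ger0_norm ?powR_ge0 //.
have -> : e = (e `^ r^-1) `^ r by rewrite -powRrM mulVf ?gt_eqF // powRr1 // ltW.
apply: ge0_ler_powR; rewrite ?nnegrE ?powR_ge0 // ?(ltW r0) ?(ltW s0) //.
apply: ltW; near: s; apply: lt_nbhsl; exact: powR_gt0.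
Unshelve. all: end_near. Qed.

End ContinuousFunctions.


(** * Continuous functional calculus of a positive operator *)

Section FunctionalCalculus.
Context {R : realType} {H : hilbertType R}.
Implicit Types (x y : bh H) (f g : R -> R).

Lemma cts_bounded f (K : R) : cts f -> exists2 C, 0 <= C & forall t, 0 <= t <= K -> `|f t| <= C.
Proof.
move=> [F cF Ff]; have [K0|K0] := leP 0 K; last first.
  by exists 0 => // t /andP[t0 tK]; have := lt_le_trans K0 (le_trans t0 tK); rewrite ltxx.
have [c _ hc] : exists2 c, c \in `[0, K]%R & forall t, t \in `[0, K]%R -> `|F t| <= `|F c|.
  apply: EVT_max => //; apply: continuous_subspaceT => x.
  by apply: continuous_comp; [exact: cF|exact: norm_continuous].
exists `|F c| => // t tK; have /andP[t0 _] := tK.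
by rewrite -Ff //; apply: hc; rewrite in_itv.
Qed.

Lemma cts_poly_approx f (K e : R) : cts f -> 0 < K -> 0 < e ->
  exists P : {poly R}, forall t, 0 <= t <= K -> `|P.[t] - f t| <= e.
Proof.
move=> [F cF Ff] K0 e0; have [P hP] := weierstrass cF K0 e0.
by exists P => t tK; rewrite -Ff; [exact: hP|case/andP: tK].
Qed.

Definition is_fc x f c := forall e : R, 0 < e -> exists P : {poly R},
  (forall t : R, spectrum x t%:C -> `|P.[t] - f t| <= e) /\ opb e (rpoly P x - c).

Lemma is_cfcP x f (c : bh H) : is_cfc x f c <-> is_fc x f c.
Proof.
split=> [[_ h] e /h[P [h1 h2]]|h].
  exists P; split=> // u; have := h2 u.
  by rewrite op_polyE !normE -rmorphM lecR.
split=> [|e /h[P [h1 h2]]]; first exact: bh_bounded.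
exists P; split=> // u; rewrite op_polyE !normE -rmorphM lecR.
exact: h2.
Qed.

(** Stated for bare maps, because the operator chosen by [cfc] comes without an adjoint. Two
    approximating polynomials are within [d + d] of each other on the spectrum, hence as
    operators. *)
Lemma is_cfc_uniq x f (c c' : H -> H) : psd x -> is_cfc x f c -> is_cfc x f c' -> c = c'.
Proof.
move=> px [_ h] [_ h']; apply: funext => u; apply/eqP; rewrite -subr_eq0; apply/eqP.
apply: nrm_eq0; apply/le_anti; rewrite nrm_ge0 andbT.
apply/ler_addgt0Pr => e e0; rewrite add0r.
have n1 : 0 < 4 * (nrm u + 1) by rewrite mulr_gt0 // ltr_wpDl ?nrm_ge0.
pose d := e / (4 * (nrm u + 1)); have d0 : 0 < d by rewrite divr_gt0.
have [P [hP Pc]] := h _ d0; have [Q [hQ Qc]] := h' _ d0.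
have hPQ : opb (d + d) (rpoly (P - Q) x).
  apply: opb_rpoly; [exact: psd_sa|by rewrite addr_ge0 // ltW|move=> t st].
  rewrite hornerD hornerN.
  have -> : P.[t] - Q.[t] = (P.[t] - f t) - (Q.[t] - f t) by ring.
  by apply: le_trans (ler_normB _ _) _; apply: lerD; [exact: hP|exact: hQ].
have := Pc u; have := Qc u; have := hPQ u.
rewrite !op_polyE !normE -rmorphM !lecR rpolyB bhB => h1 h2 h3.
have -> : c u - c' u = (rpoly P x u - rpoly Q x u) - (rpoly P x u - c u) + (rpoly Q x u - c' u).
  by rewrite opprB [X in _ = X + _]addrC !addrA !subrK.
have := nrmD (rpoly P x u - rpoly Q x u - (rpoly P x u - c u)) (rpoly Q x u - c' u).
have := nrmD (rpoly P x u - rpoly Q x u) (- (rpoly P x u - c u)); rewrite nrmN.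
have : d * (4 * nrm u) <= e.
  by rewrite /d mulrAC ler_pdivrMr // ler_pM2l //; lra.
lra.
Qed.

Lemma is_fc_uniq x f c c' : psd x -> is_fc x f c -> is_fc x f c' -> c = c'.
Proof.
move=> px /is_cfcP h /is_cfcP h'; apply: bh_ext => u.
by rewrite (is_cfc_uniq px h h').
Qed.

Lemma is_fc_ex x f : psd x -> cts f -> exists c, is_fc x f c.
Proof.
move=> px cf; have [K0 K00 hK0] := opb_ex x.
pose K := K0 + 1; have K_gt0 : 0 < K by rewrite /K ltr_wpDl.
have hK : opb K x by apply: opb_le hK0; rewrite lerDl.
have /choice[P hP] n : exists P : {poly R}, forall t, 0 <= t <= K -> `|P.[t] - f t| <= n.+1%:R^-1.
  by apply: cts_poly_approx => //; rewrite invr_gt0.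
have sK t : spectrum x t%:C -> 0 <= t <= K by apply: spectrum_itv => //; exact: ltW.
have small (e : R) : 0 < e -> exists N, forall n, (N <= n)%N -> n.+1%:R^-1 <= e.
  move=> e0; exists (Num.bound e^-1) => n Nn.
  rewrite -[e]invrK lef_pV2 ?posrE ?invr_gt0 //.
  apply: ltW; apply: lt_le_trans (archi_boundP _) _; first by rewrite invr_ge0 ltW.
  by rewrite ler_nat; apply: leq_trans Nn _.
have [c hc] : exists c, forall e : R, 0 < e -> exists N,
    forall n, (N <= n)%N -> opb e (rpoly (P n) x - c).
  apply: opb_cauchy => e e0; have [N hN] := small (e / 2) (divr_gt0 e0 (ltr0n R 2)).
  exists N => m n Nm Nn; rewrite -rpolyB; apply: opb_rpoly; [exact: psd_sa|exact: ltW|].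
  move=> t /sK tK; rewrite hornerD hornerN.
  have -> : (P m).[t] - (P n).[t] = ((P m).[t] - f t) - ((P n).[t] - f t) by ring.
  apply: le_trans (ler_normB _ _) _; rewrite [leRHS]splitr; apply: lerD.
    exact: le_trans (hP m t tK) (hN m Nm).
  exact: le_trans (hP n t tK) (hN n Nn).
exists c => e e0; have [N hN] := small e e0; have [N' hN'] := hc e e0.
exists (P (maxn N N')); split; last by apply: hN'; rewrite leq_maxr.
move=> t /sK tK; apply: le_trans (hP _ _ tK) _; apply: hN; exact: leq_maxl.
Qed.

Definition fc x f : bh H := xget 0 [set c | is_fc x f c].

Lemma fcP x f : psd x -> cts f -> is_fc x f (fc x f).
Proof.
move=> px cf; have [c hc] := is_fc_ex px cf.
by rewrite /fc; case: xgetP => [? _ //|/(_ c)].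
Qed.

Lemma fcE x f c : psd x -> is_fc x f c -> fc x f = c.
Proof.
move=> px hc; apply: (@is_fc_uniq x f) => //.
by rewrite /fc; case: xgetP => [? _ //|/(_ c)].
Qed.

Lemma cfcE x f : psd x -> cts f -> cfc x f = fc x f.
Proof.
move=> px cf; have /is_cfcP hc := fcP px cf.
rewrite /cfc; case: xgetP => [c _ h|/(_ _ hc)//].
exact: is_cfc_uniq px h hc.
Qed.

Lemma spectrum_ge0 x (t : R) : psd x -> spectrum x t%:C -> 0 <= t.
Proof.
move=> px st; have [K K0 hK] := opb_ex x.
by have /andP[] := spectrum_itv K0 px hK st.
Qed.

Lemma fc_ext x f g : psd x -> (forall t, 0 <= t -> f t = g t) -> fc x f = fc x g.
Proof.
move=> px fg; rewrite /fc; congr xget; apply/seteqP; split=> c /= h e e0;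
  have [P [h1 h2]] := h e e0; exists P; split=> // t st;
  by have := h1 t st; rewrite fg // (spectrum_ge0 px st).
Qed.

Lemma fc_poly x (P : {poly R}) : psd x -> fc x (horner P) = rpoly P x.
Proof.
move=> px; apply: fcE => // e e0; exists P; rewrite !subrr; split.
  by move=> t _; rewrite subrr normr0 ltW.
by move=> u; rewrite nrm0 mulr_ge0 ?nrm_ge0 // ltW.
Qed.

Lemma fc_cst x (c : R) : psd x -> fc x (fun=> c) = sca c.
Proof.
move=> px; rewrite -(rpolyC c x) -fc_poly //; apply: fc_ext => // t _.
by rewrite hornerC.
Qed.

Lemma fc_id x : psd x -> fc x id = x.
Proof.
move=> px; rewrite -[RHS](rpolyX x) -fc_poly //; apply: fc_ext => // t _.
by rewrite hornerX.
Qed.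

Lemma fcD x f g : psd x -> cts f -> cts g -> fc x (fun t => f t + g t) = fc x f + fc x g.
Proof.
move=> px cf cg; apply: fcE => // e e0; have e2 : 0 < e / 2 by rewrite divr_gt0.
have [P [h1 h2]] := fcP px cf e2; have [Q [h3 h4]] := fcP px cg e2.
exists (P + Q); split=> [t st|].
  rewrite hornerD opprD addrACA; have := h1 t st; have := h3 t st.
  have := ler_normD (P.[t] - f t) (Q.[t] - g t); lra.
rewrite rpolyD opprD addrACA; apply: opb_le (opbD h2 h4); lra.
Qed.

Lemma fcM x f g : psd x -> cts f -> cts g -> fc x (fun t => f t * g t) = fc x f * fc x g.
Proof.
move=> px cf cg; apply: fcE => // e e0.
have [K K0 hK] := opb_ex x.
have [A A0 hA] := cts_bounded K cf; have [B B0 hB] := cts_bounded K cg.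
have [C C0 hC] := opb_ex (fc x f); have [D D0 hD] := opb_ex (fc x g).
(* [A] and [B] bound the functions on the spectrum, [C] and [D] the operators. With [d <= 1] the
   scalar error and the operator error of the product are both at most [d * S]. *)
pose S := A + B + C + D + 2.
have S0 : 0 < S by rewrite /S; lra.
pose d := Num.min 1 (e / S); have d0 : 0 < d by rewrite lt_min ltr01 divr_gt0.
have d1 : d <= 1 by rewrite ge_min lexx.
have dS : d * S <= e by rewrite -ler_pdivlMr // ge_min lexx orbT.
have [P [h1 h2]] := fcP px cf d0; have [Q [h3 h4]] := fcP px cg d0.
exists (P * Q); split=> [t st|].
  have tK := spectrum_itv K0 px hK st.
  rewrite hornerM; have -> : P.[t] * Q.[t] - f t * g t =
    (P.[t] - f t) * (Q.[t] - g t) + (P.[t] - f t) * g t + f t * (Q.[t] - g t) by ring.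
  have := ler_normD ((P.[t] - f t) * (Q.[t] - g t) + (P.[t] - f t) * g t) (f t * (Q.[t] - g t)).
  have := ler_normD ((P.[t] - f t) * (Q.[t] - g t)) ((P.[t] - f t) * g t).
  rewrite !normrM.
  have := ler_pM (normr_ge0 _) (normr_ge0 _) (h1 t st) (h3 t st).
  have := ler_pM (normr_ge0 _) (normr_ge0 _) (h1 t st) (hB t tK).
  have := ler_pM (normr_ge0 _) (normr_ge0 _) (hA t tK) (h3 t st).
  have : d * d <= d * 1 by rewrite ler_pM2l.
  have : 0 <= d * C by rewrite mulr_ge0 // ltW.
  have : 0 <= d * D by rewrite mulr_ge0 // ltW.
  rewrite /S in dS; lra.
rewrite rpolyM; set p := rpoly P x in h2 *; set q := rpoly Q x in h4 *.
have -> : p * q - fc x f * fc x g =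
   (p - fc x f) * (q - fc x g) + (p - fc x f) * fc x g + fc x f * (q - fc x g).
  by rewrite -mulrDr subrK mulrBl mulrBr addrA subrK.
have d0' := ltW d0.
apply: opb_le (opbD (opbD (opbM d0' h2 h4) (opbM d0' h2 hD)) (opbM C0 hC h4)).
have : d * d <= d * 1 by rewrite ler_pM2l.
have : 0 <= d * A by rewrite mulr_ge0 // ltW.
have : 0 <= d * B by rewrite mulr_ge0 // ltW.
rewrite /S in dS; lra.
Qed.

Lemma fcN x f : psd x -> cts f -> fc x (fun t => - f t) = - fc x f.
Proof.
move=> px cf; rewrite -[RHS]mulN1r -sca1 -scaN -(fc_cst (-1) px).
rewrite -fcM //; last exact: cts_cst.
by apply: fc_ext => // t _; rewrite mulN1r.
Qed.

Lemma fcB x f g : psd x -> cts f -> cts g -> fc x (fun t => f t - g t) = fc x f - fc x g.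
Proof. by move=> px cf cg; rewrite fcD ?fcN //; exact: ctsN. Qed.

Lemma star_fc x f : psd x -> cts f -> star (fc x f) = fc x f.
Proof.
move=> px cf; apply/esym/fcE => // e e0; have [P [h1 h2]] := fcP px cf e0.
exists P; split=> //; rewrite -(star_rpoly P (psd_sa px)) -starB.
exact: opb_star (ltW e0) h2.
Qed.

(** By multiplicativity [fc x f] is [star w * w] with [w] the calculus of the square root of [f].
    Pointwise inequalities thus become operator inequalities. *)
Lemma fc_psd x f : psd x -> cts f -> (forall t, 0 <= t -> 0 <= f t) -> psd (fc x f).
Proof.
move=> px cf f0.
have cs : cts (fun t => Num.sqrt (f t)) by apply: cts_comp => //; exact: cts_sqrt.
rewrite (_ : fc x f = star (fc x (fun t => Num.sqrt (f t))) * fc x (fun t => Num.sqrt (f t))).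
  exact: psd_sqr.
rewrite star_fc // -fcM //; apply: fc_ext => // t t0.
by rewrite -expr2 sqr_sqrtr // f0.
Qed.

Lemma fc_opb x f (K C : R) : psd x -> opb K x -> cts f ->
  (forall t, 0 <= t <= K -> `|f t| <= C) -> 0 <= K -> 0 <= C -> opb C (fc x f).
Proof.
move=> px hK cf hC K0 C0 u; apply/ler_addgt0Pr => e e0.
have n1 : 0 < 2 * (nrm u + 1) by rewrite mulr_gt0 // ltr_wpDl ?nrm_ge0.
pose d := e / (2 * (nrm u + 1)); have d0 : 0 < d by rewrite divr_gt0.
have [P [h1 h2]] := fcP px cf d0.
have hP : opb (C + d) (rpoly P x).
  apply: opb_rpoly; [exact: psd_sa|by rewrite addr_ge0 // ltW|move=> t st].
  have := hC t (spectrum_itv K0 px hK st); have := h1 t st.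
  by have := ler_normD (f t) (P.[t] - f t); rewrite addrC subrK; lra.
have := hP u; have := h2 u; have := nrmD (rpoly P x u) (- (rpoly P x u - fc x f u)).
rewrite nrmN opprB addrC subrK -bhB.
have : d * (2 * nrm u) <= e.
  by rewrite /d mulrAC ler_pdivrMr // ler_pM2l //; lra.
lra.
Qed.

Lemma fc_horner x f (P : {poly R}) : psd x -> cts f ->
  cts (fun t => P.[f t]) /\ rpoly P (fc x f) = fc x (fun t => P.[f t]).
Proof.
move=> px cf; elim/poly_ind: P => [|P c [cP IH]].
  split; first by apply: cts_ext (cts_cst 0) => t _; rewrite horner0.
  rewrite -[0 in LHS]/(0%:P) rpolyC -(fc_cst 0 px); apply: fc_ext => // t _.
  by rewrite horner0.
have cPf := ctsM cP cf; have cc : cts (fun=> c : R) by exact: cts_cst.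
have e t : P.[f t] * f t + c = (P * 'X + c%:P).[f t] by rewrite hornerMXaddC.
split; first by apply: (cts_ext _ (ctsD cPf cc)) => t _; rewrite e.
rewrite rpolyD rpolyM rpolyX rpolyC IH -(fc_cst c px) -fcM // -fcD //.
by apply: fc_ext => // t _; rewrite e.
Qed.

Lemma fc_comp x f g : psd x -> cts f -> (forall t, 0 <= t -> 0 <= f t) -> cts g ->
  fc (fc x f) g = fc x (fun t => g (f t)).
Proof.
move=> px cf f0 cg; have pf := fc_psd px cf f0.
have cgf := cts_comp f0 cf cg.
apply: fcE => // e e0.
have [K K0 hK] := opb_ex x; have [C C0 hC] := opb_ex (fc x f).
have [A A0 hA] := cts_bounded K cf.
(* [0, L] contains both the spectrum of [fc x f], bounded by [C], and the values of [f] on [0, K],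
   bounded by [A], so one polynomial approximates [g] on both. *)
pose L := C + A + 1; have L0 : 0 < L by rewrite /L; lra.
have [P hP] := cts_poly_approx cg L0 e0.
have [cP eP] := fc_horner P px cf.
exists P; split=> [t st|].
  have /andP[t0 tC] := spectrum_itv C0 pf hC st.
  by apply: hP; rewrite t0 /L; lra.
rewrite eP -fcB //; apply: (fc_opb px hK); [exact: ctsB|move=> t tK|exact: K0|exact: ltW].
have /andP[t0 _] := tK; apply: hP; rewrite f0 //= /L.
by have := hA t tK; have := ler_norm (f t); lra.
Qed.

Lemma fc_commute x f (y : H -> H) : psd x -> cts f -> bounded_op y ->
  y \o x = x \o y -> y \o fc x f = fc x f \o y.
Proof.
move=> px cf by_ yx; have /bounded_opP[ly [C0 hC0]] := by_.
apply: funext => u /=; apply/eqP; rewrite -subr_eq0; apply/eqP/nrm_eq0.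
apply/le_anti; rewrite nrm_ge0 andbT; apply/ler_addgt0Pr => e e0; rewrite add0r.
pose C := `|C0|; have hC v : nrm (y v) <= C * nrm v.
  by apply: le_trans (hC0 v) _; rewrite ler_wpM2r ?nrm_ge0 // ler_norm.
have C00 : 0 <= C by exact: normr_ge0.
have n1 : 0 < 2 * (C * nrm u + 1) by rewrite mulr_gt0 // ltr_wpDl ?mulr_ge0 ?nrm_ge0.
pose d := e / (2 * (C * nrm u + 1)); have d0 : 0 < d by rewrite divr_gt0.
have [P [_ h]] := fcP px cf d0.
have yB v w : y (v - w) = y v - y w.
  by have := ly (-1) w v; rewrite !scaleN1r (addrC (- w)) (addrC (- y w)).
have yP := commutes_rpoly P ly (fun v => congr1 (fun k : H -> H => k v) yx) u.
have -> : y (fc x f u) - fc x f (y u) =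
   (rpoly P x (y u) - fc x f (y u)) - y (rpoly P x u - fc x f u).
  by rewrite yB yP opprB [RHS]addrC addrA subrK.
have := nrmD (rpoly P x (y u) - fc x f (y u)) (- y (rpoly P x u - fc x f u)).
rewrite nrmN; have := hC (rpoly P x u - fc x f u); rewrite -!bhB.
have := h (y u); have := h u; have := hC u => i1 i2 i3 i4.
have j1 : C * nrm ((rpoly P x - fc x f) u) <= C * (d * nrm u) by rewrite ler_wpM2l.
have j2 : d * nrm (y u) <= d * (C * nrm u) by rewrite ler_pM2l.
have : d * (2 * (C * nrm u)) <= e.
  by rewrite /d mulrAC ler_pdivrMr // ler_pM2l //; lra.
lra.
Qed.

End FunctionalCalculus.


(** * The trace and its square integrable operators *)

Section Trace.
Context {R : realType} {H : hilbertType R}.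
Variables (M : set (H -> H)) (tr : (H -> H) -> \bar R).
Hypotheses (hM : von_neumann_algebra M) (htr : is_trace M tr).
Implicit Types (x y z : bh H).

Definition inM x := M (bh_fun x).
Definition trb x := tr (bh_fun x).
(** [fine] sends an infinite trace to 0, so the value is meaningful under [fintr] only. *)
Definition trf x : R := fine (trb x).

Lemma inMD x y : inM x -> inM y -> inM (x + y).
Proof. exact: vna_add. Qed.
Lemma inMZ c x : inM x -> inM (c *: x).
Proof. exact: vna_scale. Qed.
Lemma inMN x : inM x -> inM (- x).
Proof. by move=> mx; rewrite -scaleN1r; exact: inMZ. Qed.
Lemma inMB x y : inM x -> inM y -> inM (x - y).
Proof. by move=> mx /inMN; exact: inMD. Qed.
Lemma inMM x y : inM x -> inM y -> inM (x * y).
Proof. exact: vna_mul. Qed.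
Lemma inM_star x : inM x -> inM (star x).
Proof. exact: vna_adj. Qed.

(** What commutes with [x] commutes with polynomials in [x] and their norm limits, so [fc x f] lies
    in the bicommutant. *)
Lemma inM_fc x f : inM x -> psd x -> cts f -> inM (fc x f).
Proof.
move=> mx px cf; rewrite /inM -(vna_bicommutant hM); split; first exact: bh_bounded.
move=> y [by_ hy]; apply/esym; apply: fc_commute => //; exact: hy.
Qed.

Lemma inM_sca t : inM (sca t).
Proof.
rewrite /inM -(vna_bicommutant hM); split; first exact: bh_bounded.
move=> y [by_ _]; have /bounded_opP[ly _] := by_.
apply: funext => u /=; have := ly t%:C u 0.
have -> : y 0 = 0 by have := ly (-1) 0 0; rewrite scaler0 addr0 scaleN1r addNr.
by rewrite !addr0.
Qed.

Lemma inM1 : inM 1.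
Proof. by rewrite -sca1; exact: inM_sca. Qed.

Lemma pos_coneP x : inM x -> psd x -> pos_cone M x.
Proof. by move=> mx /positive_opP. Qed.

Lemma trb_ge0 x : inM x -> psd x -> (0 <= trb x)%E.
Proof. by move=> mx px; apply: (trace_ge0 htr); exact: pos_coneP. Qed.

Lemma trbD x y : inM x -> psd x -> inM y -> psd y -> trb (x + y) = (trb x + trb y)%E.
Proof. by move=> mx px my py; apply: (trace_add htr); exact: pos_coneP. Qed.

Lemma trbZ (l : R) x : 0 <= l -> inM x -> psd x -> trb (l%:C *: x) = (l%:E * trb x)%E.
Proof. by move=> l0 mx px; apply: (trace_scale htr) => //; exact: pos_coneP. Qed.

Lemma trb0 : trb 0 = 0%E.
Proof.
rewrite -(scale0r (1 : bh H)) -[0]/(0%:C) trbZ ?mul0e //; [exact: inM1|exact: psd1].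
Qed.

Lemma trb_star_sqr x : inM x -> trb (star x * x) = trb (x * star x).
Proof. exact: (trace_adj htr). Qed.

Lemma trb_le x y : inM x -> psd x -> inM y -> psd (y - x) -> (trb x <= trb y)%E.
Proof.
move=> mx px my pyx; rewrite -(subrK x y) addrC trbD //; last exact: inMB.
by rewrite leeDl // trb_ge0 //; exact: inMB.
Qed.

Definition fintr x := [/\ inM x, psd x & (trb x < +oo)%E].

Lemma fintrE x : fintr x -> trb x = (trf x)%:E.
Proof.
by move=> [mx px fx]; rewrite /trf fineK // ge0_fin_numE // trb_ge0.
Qed.

Lemma trf_ge0 x : fintr x -> 0 <= trf x.
Proof. by move=> fx; have [mx px _] := fx; rewrite -lee_fin -fintrE // trb_ge0. Qed.

Lemma fintrD x y : fintr x -> fintr y -> fintr (x + y) /\ trf (x + y) = trf x + trf y.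
Proof.
move=> fx fy; have [mx px tx] := fx; have [my py ty] := fy.
have e : trb (x + y) = (trf x + trf y)%:E by rewrite trbD // !fintrE.
split; last by rewrite {1}/trf e.
by split; [exact: inMD|exact: psdD|rewrite e ltry].
Qed.

Lemma fintrZ (l : R) x : 0 <= l -> fintr x -> fintr (l%:C *: x) /\ trf (l%:C *: x) = l * trf x.
Proof.
move=> l0 fx; have [mx px tx] := fx.
have e : trb (l%:C *: x) = (l * trf x)%:E by rewrite trbZ // fintrE.
split; last by rewrite {1}/trf e.
by split; [exact: inMZ|exact: psdZ|rewrite e ltry].
Qed.

Lemma fintr_le x y : inM x -> psd x -> fintr y -> psd (y - x) -> fintr x /\ trf x <= trf y.
Proof.
move=> mx px fy pyx; have [my py ty] := fy.
have le := trb_le mx px my pyx.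
have fx : fintr x by split=> //; exact: le_lt_trans ty.
by split=> //; rewrite -lee_fin -!fintrE.
Qed.

Definition L2 x := inM x /\ (trb (star x * x)%R < +oo)%E.
Definition nr2 x := trf (star x * x).

Lemma L2_in x : L2 x -> inM x. Proof. by case. Qed.

Lemma L2_fintr x : L2 x -> fintr (star x * x).
Proof. by move=> [mx tx]; split=> //; [apply: inMM => //; exact: inM_star|exact: psd_sqr]. Qed.

Lemma L2_star x : L2 x -> L2 (star x).
Proof.
by move=> [mx tx]; split; [exact: inM_star|rewrite starK -trb_star_sqr].
Qed.

Lemma nr2_star x : inM x -> nr2 (star x) = nr2 x.
Proof. by move=> mx; rewrite /nr2 /trf starK trb_star_sqr. Qed.

Lemma nr2_ge0 x : L2 x -> 0 <= nr2 x.
Proof. by move=> /L2_fintr/trf_ge0. Qed.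

(** Conjugate the inequality [star z * z <= C ^+ 2] by [x]. *)
Lemma L2_mull C z x : 0 <= C -> opb C z -> inM z -> L2 x ->
  L2 (z * x) /\ nr2 (z * x) <= C ^+ 2 * nr2 x.
Proof.
move=> C0 hz mz lx; have [mx _] := lx; have mzx := inMM mz mx.
have e : (C ^+ 2)%:C *: (star x * x) - star (z * x) * (z * x) =
    star x * (sca (C ^+ 2) - star z * z) * x.
  by rewrite mulrBr mulrBl starM !mulrA scc_mulr -bh_scalerAl.
have [f1 e1] := fintrZ (sqr_ge0 C) (L2_fintr lx).
have [] := @fintr_le (star (z * x) * (z * x)) _ _ _ f1.
- by apply: inMM => //; exact: inM_star.
- exact: psd_sqr.
- by rewrite e; apply: psd_conj; exact: psd_opb_sqr.
by rewrite e1 => -[_ _ t1] h; split.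
Qed.

Lemma L2M z x : inM z -> L2 x -> L2 (z * x).
Proof. by have [C C0 hC] := opb_ex z => mz lx; have [] := L2_mull C0 hC mz lx. Qed.

Lemma L2_mulr C z x : 0 <= C -> opb C z -> inM z -> L2 x ->
  L2 (x * z) /\ nr2 (x * z) <= C ^+ 2 * nr2 x.
Proof.
move=> C0 hz mz lx; have [mx _] := lx.
have [l h] := L2_mull C0 (opb_star C0 hz) (inM_star mz) (L2_star lx).
rewrite -starM in l h; split; first by rewrite -[x * z]starK; exact: L2_star.
by move: h; rewrite !nr2_star //; exact: inMM.
Qed.

Lemma L2Mr z x : inM z -> L2 x -> L2 (x * z).
Proof. by have [C C0 hC] := opb_ex z => mz lx; have [] := L2_mulr C0 hC mz lx. Qed.

Definition sym2 x y := star x * y + star y * x.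

Lemma star_sqrD x y : star (x + y) * (x + y) = (star x * x + star y * y) + sym2 x y.
Proof.
rewrite starD mulrDl !mulrDr /sym2 [star y * x + _]addrC addrACA.
by [].
Qed.

Lemma star_sqrB x y : star (x - y) * (x - y) = (star x * x + star y * y) - sym2 x y.
Proof.
by rewrite star_sqrD /sym2 !starN mulrNN mulrN mulNr opprD.
Qed.

(** Parallelogram law for operators: twice [star x * x + star y * y] exceeds
    [star (x + y) * (x + y)] by the positive operator [star (x - y) * (x - y)]. *)
Lemma L2D x y : L2 x -> L2 y -> L2 (x + y).
Proof.
move=> lx ly; have [mx _] := lx; have [my _] := ly.
have [f1 _] := fintrD (L2_fintr lx) (L2_fintr ly).
have [f2 _] := fintrD f1 f1.
have [] := @fintr_le (star (x + y) * (x + y)) _ _ _ f2.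
- by apply: inMM; [apply: inM_star|]; exact: inMD.
- exact: psd_sqr.
- have -> : star x * x + star y * y + (star x * x + star y * y) - star (x + y) * (x + y)
     = star (x - y) * (x - y).
    by rewrite star_sqrD star_sqrB addrKA.
  exact: psd_sqr.
by move=> [_ _ t] _; split=> //; exact: inMD.
Qed.

Lemma L2N x : L2 x -> L2 (- x).
Proof. by move=> [mx tx]; split; [exact: inMN|rewrite starN mulrNN]. Qed.

Lemma L2B x y : L2 x -> L2 y -> L2 (x - y).
Proof. by move=> lx /L2N; exact: L2D. Qed.

(* The real part of the trace inner product [tr (y^* x)]. *)
Definition tdot x y := (nr2 (x + y) - nr2 (x - y)) / 4.

Lemma nr2_parallelogram x y : L2 x -> L2 y ->
  nr2 (x + y) + nr2 (x - y) = 2 * nr2 x + 2 * nr2 y.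
Proof.
move=> lx ly; have fx := L2_fintr lx; have fy := L2_fintr ly.
have [f1 e1] := fintrD fx fy; have [f2 e2] := fintrD f1 f1.
have [_ e3] := fintrD (L2_fintr (L2D lx ly)) (L2_fintr (L2B lx ly)).
rewrite /nr2 -e3 star_sqrD star_sqrB addrACA subrr addr0 e2 e1; ring.
Qed.

(** The squares of [x + y] and [x - y] differ by twice [sym2 x y], a function of [star y * x]. The
    identity is transposed so that each side is the trace of a sum of two positive operators. *)
Lemma tdot_prod x y x' y' : L2 x -> L2 y -> L2 x' -> L2 y' ->
  star y * x = star y' * x' -> tdot x y = tdot x' y'.
Proof.
move=> lx ly lx' ly' e; rewrite /tdot; congr (_ / _).
have es : sym2 x y = sym2 x' y'.
  by rewrite /sym2 e -[star x * y]starK starM starK e starM starK.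
have [_ e1] := fintrD (L2_fintr (L2D lx ly)) (L2_fintr (L2B lx' ly')).
have [_ e2] := fintrD (L2_fintr (L2D lx' ly')) (L2_fintr (L2B lx ly)).
suff : nr2 (x + y) + nr2 (x' - y') = nr2 (x' + y') + nr2 (x - y) by lra.
rewrite /nr2 -e1 -e2 !star_sqrB !star_sqrD es; congr trf.
by rewrite addrACA [RHS]addrACA; congr (_ + _); rewrite addrC.
Qed.

Lemma tdot_adjl x y z : inM z -> L2 x -> L2 y -> tdot (z * x) y = tdot x (star z * y).
Proof.
move=> mz lx ly; apply: tdot_prod => //; [exact: L2M| |].
  by apply: L2M => //; exact: inM_star.
by rewrite starM starK mulrA.
Qed.

Lemma tdot_star x y : L2 x -> L2 y -> tdot (star x) (star y) = tdot x y.
Proof.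
move=> lx ly; rewrite /tdot -starD -starB !nr2_star //; apply: L2_in; [exact: L2B|exact: L2D].
Qed.

(** The two products, [star y * x * z] and [z * star y * x], differ, so [tdot_prod] does not apply
    directly. Traciality enters here, through [tdot_star]. *)
Lemma tdot_adjr x y z : inM z -> L2 x -> L2 y -> tdot (x * z) y = tdot x (y * star z).
Proof.
move=> mz lx ly; have msz := inM_star mz.
rewrite -tdot_star //; last exact: L2Mr.
rewrite starM tdot_adjl //; [|exact: L2_star|exact: L2_star].
rewrite -starM tdot_star //; exact: L2Mr.
Qed.

Lemma tdotxx x : L2 x -> tdot x x = nr2 x.
Proof.
move=> lx; have := nr2_parallelogram lx lx.
have n0 : nr2 0 = 0 by rewrite /nr2 mulr0 /trf trb0.
rewrite /tdot subrr n0; lra.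
Qed.

Lemma nr2B x y : L2 x -> L2 y -> nr2 (x - y) = nr2 x + nr2 y - 2 * tdot x y.
Proof. by move=> lx ly; have := nr2_parallelogram lx ly; rewrite /tdot; lra. Qed.

Lemma tdot_le x y : L2 x -> L2 y -> 2 * tdot x y <= nr2 x + nr2 y.
Proof. by move=> lx ly; have := nr2_ge0 (L2B lx ly); rewrite nr2B //; lra. Qed.

End Trace.


(** * Bounded midpoint convex functions *)

Section MidpointConvexity.
Context {R : realType}.

(* If [f <= C] on [u, w] then [f <= C / 2] there, because any point of [u, w] is the midpoint
   of an endpoint and another point of the interval; no continuity is needed. *)
Lemma midpoint_convex_le0 (f : R -> R) (u w B : R) :
  (forall x y, u <= x -> x <= y -> y <= w -> f ((x + y) / 2) <= (f x + f y) / 2) ->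
  (forall x, u <= x <= w -> f x <= B) -> f u <= 0 -> f w <= 0 ->
  forall x, u <= x <= w -> f x <= 0.
Proof.
move=> mf fB fu fw.
have step (C : R) : (forall x, u <= x <= w -> f x <= C) -> forall x, u <= x <= w -> f x <= C / 2.
  move=> fC x /andP[ux xw]; have [h|h] := leP (2 * x - u) w.
    have := mf u (2 * x - u) (lexx _); rewrite (_ : (u + (2 * x - u)) / 2 = x); last by field.
    have : f (2 * x - u) <= C by apply: fC; apply/andP; split; lra.
    move=> h1 /(_ _ h) h2; have := h2 ltac:(lra); lra.
  have := mf (2 * x - w) w _ _ (lexx _).
  rewrite (_ : (2 * x - w + w) / 2 = x); last by field.
  have : f (2 * x - w) <= C by apply: fC; apply/andP; split; lra.
  move=> h1 h2; have := h2 ltac:(lra) ltac:(lra); lra.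
have halves n : forall x, u <= x <= w -> f x <= B / 2 ^+ n.
  elim: n => [|n IH]; first by rewrite expr0 divr1.
  by rewrite exprSr invfM mulrA; exact: step.
move=> x xuw; rewrite leNgt; apply/negP => fx0.
pose n := Num.bound (`|B| / f x).
have := halves n x xuw; rewrite ler_pdivlMr ?exprn_gt0 // leNgt => /negP; apply.
apply: le_lt_trans (ler_norm _) _; rewrite mulrC -ltr_pdivrMr //.
apply: lt_trans (archi_boundP _) _; first by rewrite divr_ge0 // ltW.
by rewrite -/n -natrX ltr_nat ltn_expl.
Qed.

Lemma midpoint_convex_le_affine (f : R -> R) (c k u w B : R) :
  (forall x y, u <= x -> x <= y -> y <= w -> f ((x + y) / 2) <= (f x + f y) / 2) ->
  (forall x, u <= x <= w -> f x <= B) -> f u <= c + k * u -> f w <= c + k * w ->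
  forall x, u <= x <= w -> f x <= c + k * x.
Proof.
move=> mf fB fu fw x xuw; rewrite -subr_le0.
apply: (@midpoint_convex_le0 (fun t => f t - (c + k * t)) u w (B + `|c| + `|k| * (`|u| + `|w|)));
  rewrite ?subr_le0 //.
  move=> s t us st tw; have := mf s t us st tw; lra.
move=> t /andP[ut tw]; have := fB t; rewrite ut tw => /(_ isT).
have : - (k * t) <= `|k| * (`|u| + `|w|).
  apply: le_trans (ler_norm _) _; rewrite normrN normrM ler_wpM2l // ler_norml.
  have := ler_norm u; have := ler_norm (- u); have := ler_norm w; have := ler_norm (- w).
  rewrite !normrN; have := normr_ge0 u; have := normr_ge0 w; lra.
have := ler_norm (- c); rewrite normrN; lra.
Qed.

(** A value at 1/2 lying [N / 2] below the chord lets [g] be compared with the broken line through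
    that lower point; its distance to the chord is the tent function [Num.min s (1 - s) * N]. *)
Lemma midpoint_convex_defect (g : R -> R) (A B N C : R) :
  (forall x y, 0 <= x -> x <= y -> y <= 1 -> g ((x + y) / 2) <= (g x + g y) / 2) ->
  (forall x, 0 <= x <= 1 -> g x <= C) -> g 0 <= B -> g 1 <= A ->
  g (1 / 2) = (A + B) / 2 - N / 2 ->
  forall s, 0 <= s <= 1 -> g s <= B + (A - B) * s - Num.min s (1 - s) * N.
Proof.
move=> mg hC e0 e1 em s /andP[s0 s1]; have [s2|s2] := leP s (1 - s).
  have -> : B + (A - B) * s - s * N = B + (A - B - N) * s by ring.
  apply: (@midpoint_convex_le_affine g _ _ 0 (1 / 2) C).
  - by move=> x y x0 xy y1; apply: mg => //; lra.
  - by move=> x /andP[x0 x1]; apply: hC; apply/andP; split; lra.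
  - by rewrite mulr0 addr0.
  - by rewrite em; lra.
  by apply/andP; split; lra.
have -> : B + (A - B) * s - (1 - s) * N = (B - N) + (A - B + N) * s by ring.
apply: (@midpoint_convex_le_affine g _ _ (1 / 2) 1 C).
- by move=> x y x0 xy y1; apply: mg => //; lra.
- by move=> x /andP[x0 x1]; apply: hC; apply/andP; split; lra.
- by rewrite em; lra.
- by apply: (le_trans e1); lra.
by apply/andP; split; lra.
Qed.

End MidpointConvexity.

(** * Powers of a positive operator *)

Section Powers.
Context {R : realType} {H : hilbertType R}.
Implicit Types (x y : bh H).

Definition pw x (r : R) := fc x (fun t => t `^ r).

Lemma op_powE x r : psd x -> 0 <= r -> op_pow x r = pw x r.
Proof. by move=> px r0; rewrite /op_pow cfcE //; exact: cts_powR. Qed.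

Lemma pwD x r s : psd x -> 0 <= r -> 0 <= s -> pw x (r + s) = pw x r * pw x s.
Proof.
move=> px r0 s0; rewrite -fcM; [|exact: px|exact: cts_powR|exact: cts_powR].
(* At [t = 0] the law of exponents in [powRD] is guarded by [r + s != 0]. For nonnegative exponents
   the guard can fail only if [r = 0], which is treated directly. *)
apply: fc_ext => // t t0; have [r00|rn0] := eqVneq r 0; first by rewrite r00 add0r powRr0 mul1r.
by rewrite powRD //; apply/implyP => /eqP h; move: rn0; rewrite (_ : r = 0) ?eqxx //; lra.
Qed.

Lemma pw0 x : psd x -> pw x 0 = 1.
Proof. by move=> px; rewrite /pw -sca1 -(fc_cst 1 px); apply: fc_ext => // t _; rewrite powRr0. Qed.

Lemma pw1 x : psd x -> pw x 1 = x.
Proof. by move=> px; rewrite -[RHS]fc_id //; apply: fc_ext => // t t0; rewrite powRr1. Qed.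

Lemma star_pw x r : psd x -> 0 <= r -> star (pw x r) = pw x r.
Proof. by move=> px r0; apply: star_fc => //; exact: cts_powR. Qed.

Lemma psd_pw x r : psd x -> 0 <= r -> psd (pw x r).
Proof. by move=> px r0; apply: fc_psd => // [|t t0]; [exact: cts_powR|exact: powR_ge0]. Qed.

Lemma pw_pw x r s : psd x -> 0 <= r -> 0 <= s -> pw (pw x r) s = pw x (r * s).
Proof.
move=> px r0 s0; rewrite /pw fc_comp //; [|exact: cts_powR| |exact: cts_powR].
  by apply: fc_ext => // t _; rewrite powRrM.
by move=> t _; exact: powR_ge0.
Qed.

(** A base at least 1 makes the bound uniform over the exponents up to [s], as required along a
    whole path. *)
Lemma opb_pw x (K r s : R) : psd x -> 1 <= K -> opb K x -> 0 <= r -> r <= s ->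
  opb (K `^ s) (pw x r).
Proof.
move=> px K1 hK r0 rs; apply: (fc_opb px hK); [exact: cts_powR| |lra|exact: powR_ge0].
move=> t /andP[t0 tK]; rewrite ger0_norm ?powR_ge0 //.
apply: (@le_trans _ _ (K `^ r)); last by apply: ler_powR.
by apply: ge0_ler_powR; rewrite ?nnegrE //; lra.
Qed.

End Powers.

Local Opaque pw.

(** * Midpoint convexity and boundedness along the path *)

Section Young.
Context {R : realType} {H : hilbertType R}.
Variables (M : set (H -> H)) (tr : (H -> H) -> \bar R).
Hypotheses (hM : von_neumann_algebra M) (htr : is_trace M tr).
Variables (a b : bh H).
Hypotheses (fa : fintr M tr a) (fb : fintr M tr b).

Let Ma : inM M a. Proof. by case: fa. Qed.
Let Mb : inM M b. Proof. by case: fb. Qed.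
Let pa : psd a. Proof. by case: fa. Qed.
Let pb : psd b. Proof. by case: fb. Qed.

Lemma inM_pw x r : inM M x -> psd x -> 0 <= r -> inM M (pw x r).
Proof. by move=> mx px r0; apply: inM_fc => //; exact: cts_powR. Qed.

Lemma L2_sqrt x : fintr M tr x -> L2 M tr (pw x 2^-1).
Proof.
move=> [mx px tx]; have h0 : 0 <= 2^-1 :> R by rewrite invr_ge0.
split; first exact: inM_pw.
by rewrite star_pw // -pwD // -[2^-1]mul1r -splitr pw1.
Qed.

(** The bounded operator x^(r - 1/2) multiplies the square integrable x^(1/2). *)
Lemma L2_pw x r : fintr M tr x -> 2^-1 <= r -> L2 M tr (pw x r).
Proof.
move=> fx r2; have [mx px tx] := fx; rewrite -(subrK 2^-1 r).
have h0 : 0 <= 2^-1 :> R by rewrite invr_ge0.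
rewrite pwD //; last by rewrite subr_ge0.
apply: (L2M hM htr) (L2_sqrt fx).
by apply: inM_pw => //; rewrite subr_ge0.
Qed.

Lemma nr2_pw x r : psd x -> 0 <= r -> nr2 tr (pw x r) = trf tr (pw x (r + r)).
Proof. by move=> px r0; rewrite /nr2 star_pw // -pwD. Qed.

Lemma L2_pw_mul v al be : inM M v -> 0 <= al -> 0 <= be -> 2^-1 <= al \/ 2^-1 <= be ->
  L2 M tr (pw a al * v * pw b be).
Proof.
move=> mv al0 be0 [h|h].
  apply: (L2Mr hM htr); first exact: inM_pw.
  exact: (L2Mr hM htr mv) (L2_pw fa h).
apply: (L2M hM htr) (L2_pw fb h).
by apply: (inMM hM) => //; exact: inM_pw.
Qed.

(* Powers are moved past the trace one factor at a time; the disjunction provides an intermediate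
   product that is still square integrable. *)
Lemma tdot_pw_mid v al be d e : inM M v -> 0 <= al -> 0 <= be -> 0 <= d -> 0 <= e ->
  L2 M tr (pw a al * v * pw b (be + e + e)) ->
  L2 M tr (pw a (al + d + d) * v * pw b be) ->
  2^-1 <= al + d \/ 2^-1 <= be + e ->
  tdot tr (pw a al * v * pw b (be + e + e)) (pw a (al + d + d) * v * pw b be) =
  nr2 tr (pw a (al + d) * v * pw b (be + e)).
Proof.
move=> mv al0 be0 d0 e0 ls lt h.
have ald : 0 <= al + d by exact: addr_ge0.
have bee : 0 <= be + e by exact: addr_ge0.
have lr : L2 M tr (pw a (al + d) * v * pw b (be + e)) by exact: L2_pw_mul.
have mad : inM M (pw a d) by exact: inM_pw.
have mbe : inM M (pw b e) by exact: inM_pw.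
have pa1 : pw a (al + d) = pw a d * pw a al by rewrite addrC -pwD.
have pa2 : pw a (al + d + d) = pw a d * pw a (al + d) by rewrite -pwD // addrC.
have pb1 : pw b (be + e) = pw b be * pw b e by rewrite -pwD.
have pb2 : pw b (be + e + e) = pw b (be + e) * pw b e by rewrite -pwD.
(* If [al + d] is at least 1/2, the [a]-power moves first and then the [b]-power; otherwise the
   order is reversed. *)
case: h => h.
  have lu : L2 M tr (pw a (al + d) * v * pw b be) by apply: L2_pw_mul => //; left.
  have -> : pw a (al + d + d) * v * pw b be = star (pw a d) * (pw a (al + d) * v * pw b be).
    by rewrite (star_pw pa d0) pa2 !mulrA.
  rewrite -(tdot_adjl hM htr) //.
  have -> : pw a d * (pw a al * v * pw b (be + e + e)) = pw a (al + d) * v * pw b (be + e) * pw b e.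
    by rewrite pb2 pa1 !mulrA.
  rewrite (tdot_adjr hM htr) // star_pw // -[X in tdot _ _ X]mulrA -pb1.
  by rewrite (tdotxx hM htr).
have lw : L2 M tr (pw a al * v * pw b (be + e)) by apply: L2_pw_mul => //; right.
have -> : pw a al * v * pw b (be + e + e) = pw a al * v * pw b (be + e) * pw b e.
  by rewrite pb2 !mulrA.
rewrite (tdot_adjr hM htr) // star_pw //.
have -> : pw a (al + d + d) * v * pw b be * pw b e =
    star (pw a d) * (pw a (al + d) * v * pw b (be + e)).
  by rewrite (star_pw pa d0) pa2 pb1 !mulrA.
rewrite -(tdot_adjl hM htr) //.
have -> : pw a d * (pw a al * v * pw b (be + e)) = pw a (al + d) * v * pw b (be + e).
  by rewrite pa1 !mulrA.
by rewrite (tdotxx hM htr).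
Qed.

Variables (p q : R).
Hypotheses (p0 : 0 < p) (q0 : 0 < q) (pq : p^-1 + q^-1 = 1).

Definition young_path v s := pw a (p * s / 2) * v * pw b (q * (1 - s) / 2).

(** Since 1 - 1/p = 1/q, both exponents equal 1/2 at s = 1/p. To the right of this point the
    exponent of [a] is larger, to the left that of [b]. *)
Let half_le v s : inM M v -> 0 <= s <= 1 -> [/\ 0 <= p * s / 2, 0 <= q * (1 - s) / 2 &
  2^-1 <= p * s / 2 \/ 2^-1 <= q * (1 - s) / 2].
Proof.
move=> mv /andP[s0 s1].
have h1 : 0 <= p * s / 2 by rewrite divr_ge0 // mulr_ge0 // ltW.
have h2 : 0 <= q * (1 - s) / 2 by rewrite divr_ge0 // mulr_ge0 ?subr_ge0 // ltW.
split=> //; have [sp|ps] := leP p^-1 s; [left|right].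
  have : 1 <= p * s by rewrite -ler_pdivrMl // mulr1.
  lra.
have : 1 <= q * (1 - s).
  rewrite -ler_pdivrMl // mulr1.
  by move: (p^-1) (q^-1) pq ps => p' q'; lra.
lra.
Qed.

Lemma L2_young_path v s : inM M v -> 0 <= s <= 1 -> L2 M tr (young_path v s).
Proof. by move=> mv s01; have [h1 h2 h3] := half_le mv s01; exact: L2_pw_mul. Qed.

Lemma tdot_young_path v s t : inM M v -> 0 <= s -> s <= t -> t <= 1 ->
  tdot tr (young_path v s) (young_path v t) = nr2 tr (young_path v ((s + t) / 2)).
Proof.
move=> mv s0 st t1.
have r01 : 0 <= (s + t) / 2 <= 1 by apply/andP; split; lra.
have [_ _ h] := half_le mv r01.
have ls : L2 M tr (young_path v s) by apply: L2_young_path => //; apply/andP; split; lra.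
have lt : L2 M tr (young_path v t) by apply: L2_young_path => //; apply/andP; split; lra.
have ps0 : 0 <= p * (t - s) by rewrite mulr_ge0 ?subr_ge0 // ltW.
have qs0 : 0 <= q * (t - s) by rewrite mulr_ge0 ?subr_ge0 // ltW.
have al0 : 0 <= p * s by rewrite mulr_ge0 // ltW.
have be0 : 0 <= q * (1 - t) by rewrite mulr_ge0 ?subr_ge0 // ltW.
move: ls lt h; rewrite /young_path.
(* Quarters appear because the exponents carry a factor 1/2 and the midpoint takes half of
   [t - s]. *)
have -> : p * t / 2 = p * s / 2 + p * (t - s) / 4 + p * (t - s) / 4 by field.
have -> : q * (1 - s) / 2 = q * (1 - t) / 2 + q * (t - s) / 4 + q * (t - s) / 4 by field.
have -> : p * ((s + t) / 2) / 2 = p * s / 2 + p * (t - s) / 4 by field.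
have -> : q * (1 - (s + t) / 2) / 2 = q * (1 - t) / 2 + q * (t - s) / 4 by field.
by move=> ls lt h; apply: tdot_pw_mid => //; lra.
Qed.

Lemma young_path_midpoint v s t : inM M v -> 0 <= s -> s <= t -> t <= 1 ->
  nr2 tr (young_path v ((s + t) / 2)) <= (nr2 tr (young_path v s) + nr2 tr (young_path v t)) / 2.
Proof.
move=> mv s0 st t1; rewrite -tdot_young_path //.
have := @tdot_le _ _ _ _ hM htr (young_path v s) (young_path v t).
move=> h; rewrite ler_pdivlMr // mulrC; apply: h; apply: L2_young_path => //;
  by apply/andP; split; lra.
Qed.

(** One factor a^(1/2) or b^(1/2) supplies the square norm; all remaining factors are estimated by
    operator bounds independent of [s]. The sum of the two square norms covers both cases. *)
Lemma young_path_bounded v : inM M v ->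
  exists B, forall s, 0 <= s <= 1 -> nr2 tr (young_path v s) <= B.
Proof.
move=> mv; have [Ka Ka0 ha] := opb_ex a; have [Kb Kb0 hb] := opb_ex b.
have [V V0 hV] := opb_ex v.
have ha1 : opb (Ka + 1) a by apply: opb_le ha; lra.
have hb1 : opb (Kb + 1) b by apply: opb_le hb; lra.
set A := (Ka + 1) `^ p; set B := (Kb + 1) `^ q.
have A0 : 0 <= A by exact: powR_ge0.
have B0 : 0 <= B by exact: powR_ge0.
have ABV0 : 0 <= A ^+ 2 * V ^+ 2 * B ^+ 2 by rewrite !mulr_ge0 ?sqr_ge0.
have opa r : 0 <= r -> r <= p -> opb A (pw a r) by move=> r0 rp; apply: opb_pw => //; lra.
have opb' r : 0 <= r -> r <= q -> opb B (pw b r) by move=> r0 rp; apply: opb_pw => //; lra.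
exists (A ^+ 2 * V ^+ 2 * B ^+ 2 * (nr2 tr (pw a 2^-1) + nr2 tr (pw b 2^-1))) => s s01.
clearbody A B.
have [h1 h2 h] := half_le mv s01; have /andP[s0 s1] := s01; rewrite /young_path.
have sp : p * s / 2 <= p.
  have : p * s <= p * 1 by rewrite ler_pM2l.
  by lra.
have sq : q * (1 - s) / 2 <= q.
  have : q * (1 - s) <= q * 1 by rewrite ler_pM2l //; lra.
  by lra.
have i2 : 0 <= 2^-1 :> R by rewrite invr_ge0.
have na := nr2_ge0 hM htr (L2_sqrt fa); have nb := nr2_ge0 hM htr (L2_sqrt fb).
set al := p * s / 2 in h h1 sp *; set be := q * (1 - s) / 2 in h h2 sq *.
clearbody al be.
have mbe : inM M (pw b be) by exact: inM_pw.
have mal : inM M (pw a al) by exact: inM_pw.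
case: h => h.
  have e : pw a al = pw a (al - 2^-1) * pw a 2^-1 by rewrite -pwD ?subr_ge0 // subrK.
  have hx : opb A (pw a (al - 2^-1)) by apply: opa; lra.
  have mx : inM M (pw a (al - 2^-1)) by apply: inM_pw => //; lra.
  have [l1 n1] := L2_mull hM htr A0 hx mx (L2_sqrt fa); rewrite -e in l1 n1.
  have [l2 n2] := L2_mulr hM htr V0 hV mv l1.
  have [l3 n3] := L2_mulr hM htr B0 (opb' be h2 sq) mbe l2.
  apply: le_trans n3 _; apply: (@le_trans _ _ (B ^+ 2 * (V ^+ 2 * (A ^+ 2 * nr2 tr (pw a 2^-1))))).
    by rewrite ler_wpM2l ?sqr_ge0 //; apply: le_trans n2 _; rewrite ler_wpM2l ?sqr_ge0.
  have -> : B ^+ 2 * (V ^+ 2 * (A ^+ 2 * nr2 tr (pw a 2^-1))) =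
    A ^+ 2 * V ^+ 2 * B ^+ 2 * nr2 tr (pw a 2^-1) by ring.
  by apply: ler_wpM2l; [exact: ABV0|rewrite lerDl].
have e : pw b be = pw b (be - 2^-1) * pw b 2^-1 by rewrite -pwD ?subr_ge0 // subrK.
have hx : opb B (pw b (be - 2^-1)) by apply: opb'; lra.
have mx : inM M (pw b (be - 2^-1)) by apply: inM_pw => //; lra.
have [l1 n1] := L2_mull hM htr B0 hx mx (L2_sqrt fb); rewrite -e in l1 n1.
have [l2 n2] := L2_mull hM htr V0 hV mv l1.
have [l3 n3] := L2_mull hM htr A0 (opa al h1 sp) mal l2.
rewrite -mulrA; apply: le_trans n3 _.
apply: (@le_trans _ _ (A ^+ 2 * (V ^+ 2 * (B ^+ 2 * nr2 tr (pw b 2^-1))))).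
  by rewrite ler_wpM2l ?sqr_ge0 //; apply: le_trans n2 _; rewrite ler_wpM2l ?sqr_ge0.
have -> : A ^+ 2 * (V ^+ 2 * (B ^+ 2 * nr2 tr (pw b 2^-1))) =
  A ^+ 2 * V ^+ 2 * B ^+ 2 * nr2 tr (pw b 2^-1) by ring.
by apply: ler_wpM2l; [exact: ABV0|rewrite lerDr].
Qed.

End Young.


(** * The trace inequality with its defect *)

Section TraceYoung.
Context {R : realType} {H : hilbertType R}.
Variables (M : set (H -> H)) (tr : (H -> H) -> \bar R).
Hypotheses (hM : von_neumann_algebra M) (htr : is_trace M tr).
Variables (a b : bh H).
Hypotheses (fa : fintr M tr a) (fb : fintr M tr b).
Variables (p q : R).
Hypotheses (p0 : 0 < p) (q0 : 0 < q) (pq : p^-1 + q^-1 = 1).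

Let Ma : inM M a. Proof. by case: fa. Qed.
Let Mb : inM M b. Proof. by case: fb. Qed.
Let pa : psd a. Proof. by case: fa. Qed.
Let pb : psd b. Proof. by case: fb. Qed.

Let p2 : 0 <= p / 2. Proof. by rewrite divr_ge0 // ltW. Qed.
Let q2 : 0 <= q / 2. Proof. by rewrite divr_ge0 // ltW. Qed.

(** Conjugate exponents are at least 1, which makes the endpoint operators of the path square
    integrable. *)
Let conj_ge1 (r s : R) : 0 < r -> 0 < s -> r^-1 + s^-1 = 1 -> 2^-1 <= r / 2.
Proof.
move=> r0 s0 rs; have : r^-1 <= 1 by rewrite -rs lerDl invr_ge0 ltW.
rewrite invf_le1 //; lra.
Qed.

Lemma L2_pw_half_a : L2 M tr (pw a (p / 2)).
Proof. by apply: L2_pw => //; exact: conj_ge1 q0 pq. Qed.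

Lemma L2_pw_half_b : L2 M tr (pw b (q / 2)).
Proof. by apply: L2_pw => //; apply: (@conj_ge1 _ p); rewrite // addrC. Qed.

Local Notation A := (nr2 tr (pw a (p / 2))).
Local Notation B := (nr2 tr (pw b (q / 2))).
Local Notation g v s := (nr2 tr (young_path a b p q v s)).

Lemma trf_pw_a : trf tr (pw a p) = A.
Proof. by rewrite (nr2_pw tr pa p2) -splitr. Qed.

Lemma trf_pw_b : trf tr (pw b q) = B.
Proof. by rewrite (nr2_pw tr pb q2) -splitr. Qed.

Lemma young_path0 v : young_path a b p q v 0 = v * pw b (q / 2).
Proof. by rewrite /young_path mulr0 mul0r pw0 // mul1r subr0 mulr1. Qed.

Lemma young_path1 v : young_path a b p q v 1 = pw a (p / 2) * v.
Proof. by rewrite /young_path subrr mulr0 mul0r pw0 // !mulr1. Qed.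

Lemma young_path_conj v : young_path a b p q v p^-1 = pw a 2^-1 * v * pw b 2^-1.
Proof.
rewrite /young_path (_ : 1 - p^-1 = q^-1); last by rewrite -pq addrAC subrr add0r.
by rewrite !divff ?gt_eqF // mul1r.
Qed.

Let path_le v s : inM M v -> opb 1 v -> 0 <= s <= 1 -> g v s <= B + (A - B) * s.
Proof.
move=> mv hv; have [C hC] := young_path_bounded hM htr fa fb p0 q0 pq mv.
apply: (midpoint_convex_le_affine _ hC).
- by move=> x y x0 xy y1; exact: (young_path_midpoint hM htr fa fb p0 q0 pq mv).
- rewrite young_path0 mulr0 addr0.
  by have [_] := L2_mull hM htr ler01 hv mv L2_pw_half_b; rewrite expr1n mul1r.
rewrite young_path1 mulr1 addrC subrK.
by have [_] := L2_mulr hM htr ler01 hv mv L2_pw_half_a; rewrite expr1n mul1r.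
Qed.

Local Notation defect := (nr2 tr (pw b (q / 2) - pw a (p / 2))).

(** The midpoint value is the pairing of the endpoints b^(q/2) and a^(p/2); expanding the square of
    their difference expresses it by the defect. *)
Let path1_mid : g 1 (1 / 2) = (A + B) / 2 - defect / 2.
Proof.
have m1 : inM M 1 by exact: inM1.
have := tdot_young_path hM htr fa fb p0 q0 pq m1 (lexx 0) ler01 (lexx 1).
rewrite young_path0 young_path1 mul1r mulr1 add0r => e.
by rewrite (nr2B hM htr L2_pw_half_b L2_pw_half_a) e; field.
Qed.

Let path1_le s : 0 <= s <= 1 -> g 1 s <= B + (A - B) * s - Num.min s (1 - s) * defect.
Proof.
have m1 : inM M 1 by exact: inM1.
have [C hC] := young_path_bounded hM htr fa fb p0 q0 pq m1.
apply: (midpoint_convex_defect (g := fun s => g 1 s) _ hC _ _ path1_mid).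
- by move=> x y x0 xy y1; exact: (young_path_midpoint hM htr fa fb p0 q0 pq m1).
- by have := @path_le 1 0 m1 opb1; rewrite mulr0 addr0; apply; rewrite lexx ler01.
by have := @path_le 1 1 m1 opb1; rewrite mulr1 addrC subrK; apply; rewrite lexx ler01.
Qed.

Definition young_sum := p^-1 * trf tr (pw a p) + q^-1 * trf tr (pw b q).

Let young_sumE : young_sum = B + (A - B) * p^-1.
Proof.
rewrite /young_sum trf_pw_a trf_pw_b (_ : q^-1 = 1 - p^-1); first by ring.
by rewrite -pq addrAC subrr add0r.
Qed.

Let pV01 : 0 <= p^-1 <= 1.
Proof. by rewrite invr_ge0 ltW //= -pq lerDl invr_ge0 ltW. Qed.

(** Positivity of [z] gives its trace a meaning. It is the pairing of a^(1/2) b with a^(1/2) u;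
    moving one b^(1/2) across turns this into the pairing of the paths of 1 and [u] at s = 1/p. *)
Lemma young_pairing_le (u z : bh H) : inM M u -> opb 1 u -> psd z -> star u * (a * b) = z ->
  fintr M tr z /\ trf tr z <= young_sum - Num.min p^-1 q^-1 * defect / 2.
Proof.
move=> mu hu pz ez.
have h0 : 0 <= 2^-1 :> R by rewrite invr_ge0.
have half : 2^-1 + 2^-1 = 1 :> R by rewrite -[2^-1]mul1r -splitr.
have la := L2_sqrt hM fa; have lb := L2_sqrt hM fb.
have lx : L2 M tr (pw a 2^-1 * b) by exact: (L2Mr hM htr).
have ly : L2 M tr (pw a 2^-1 * u) by exact: (L2Mr hM htr).
have exy : star (pw a 2^-1 * u) * (pw a 2^-1 * b) = z.
  by rewrite starM star_pw // -ez !mulrA -(mulrA (star u)) -pwD // half pw1.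
have mz : inM M z.
  by rewrite -ez; apply: (inMM hM); [exact: (inM_star hM)|exact: (inMM hM)].
have eyx : star (pw a 2^-1 * b) * (pw a 2^-1 * u) = z.
  by rewrite -[LHS]starK starM starK exy psd_sa.
(* With x = a^(1/2) b and y = a^(1/2) u, both cross products equal [z], so [star (x + y) * (x + y)]
   dominates [z]. *)
have fz : fintr M tr z.
  have [] // := fintr_le hM htr mz pz (L2_fintr hM (L2D hM htr lx ly)).
  rewrite star_sqrD /sym2 exy eyx addrA addrK.
  by apply: psdD => //; apply: psdD; exact: psd_sqr.
split=> //.
(* The square root writes the trace of [z] as [tdot r r], to which [tdot_prod] applies. *)
pose r := pw z 2^-1.
have er : star r * r = z by rewrite /r star_pw // -pwD // half pw1.
have lr : L2 M tr r by exact: L2_sqrt.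
have -> : trf tr z = tdot tr (pw a 2^-1 * 1 * pw b 2^-1) (pw a 2^-1 * u * pw b 2^-1).
  transitivity (tdot tr r r); first by rewrite (tdotxx hM htr) // /nr2 er.
  rewrite (tdot_prod hM htr lr lr lx ly) ?er ?exy //.
  have -> : pw a 2^-1 * b = pw a 2^-1 * 1 * pw b 2^-1 * pw b 2^-1.
    by rewrite mulr1 -mulrA -pwD // half pw1.
  rewrite (tdot_adjr hM htr) ?star_pw //; first exact: inM_pw.
  rewrite mulr1; apply: (L2Mr hM htr) => //; exact: inM_pw.
have m1 : inM M 1 by exact: inM1.
have l1 : L2 M tr (pw a 2^-1 * 1 * pw b 2^-1).
  by rewrite -young_path_conj; apply: L2_young_path.
have lu : L2 M tr (pw a 2^-1 * u * pw b 2^-1).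
  by rewrite -young_path_conj; apply: L2_young_path.
have := tdot_le hM htr l1 lu; rewrite -!young_path_conj.
have := path_le mu hu pV01; have := path1_le pV01.
rewrite -young_sumE (_ : 1 - p^-1 = q^-1); last by rewrite -pq addrAC subrr add0r.
move: (nr2 tr (young_path _ _ _ _ 1 _)) (nr2 tr (young_path _ _ _ _ u _)) (tdot _ _ _) => g1 gu T.
by move: (Num.min _ _) young_sum defect => m S N; lra.
Qed.

End TraceYoung.


(** * Approximating the absolute value from below *)

Section AbsoluteValue.
Context {R : realType} {H : hilbertType R}.
Implicit Types (x y z : bh H).

Definition babs x := pw (star x * x) 2^-1.

Lemma op_absE x : op_abs x = babs x.
Proof.
rewrite /op_abs -[adj x \o x]/(bh_fun (star x * x)) op_powE ?invr_ge0 //.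
exact: psd_sqr.
Qed.

Lemma cts_inv_sqrt_addn (e : R) : 0 < e -> cts (fun t => (Num.sqrt t + e)^-1).
Proof.
move=> e0; apply: (@cts_comp R Num.sqrt (fun t => (t + e)^-1) _ (@cts_sqrt R) (cts_inv_addn e0)).
by move=> t _; exact: sqrtr_ge0.
Qed.

Lemma cts_inv_sqrt_addn_mul (e : R) : 0 < e -> cts (fun t => (Num.sqrt t + e)^-1 * t).
Proof. by move=> e0; apply: ctsM; [exact: cts_inv_sqrt_addn|exact: cts_id]. Qed.

Lemma sqrt_addn_gt0 (e t : R) : 0 < e -> 0 < Num.sqrt t + e.
Proof. by move=> e0; rewrite ltr_wpDl ?sqrtr_ge0. Qed.

(** In terms of |x| this is |x|^2 / (|x| + e), written as a function of [star x * x]. *)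
Definition abs_approx x e := fc (star x * x) (fun t => (Num.sqrt t + e)^-1 * t).

Lemma psd_abs_approx x e : 0 < e -> psd (abs_approx x e).
Proof.
move=> e0; apply: fc_psd; [exact: psd_sqr|exact: cts_inv_sqrt_addn_mul|move=> t t0].
by rewrite mulr_ge0 // invr_ge0 ltW // sqrt_addn_gt0.
Qed.

(** With u = x (|x| + e)^(-1), [star u * u] is |x|^2 / (|x| + e)^2, which is at most 1. *)
Lemma abs_approx_contraction x e : 0 < e ->
  opb 1 (x * fc (star x * x) (fun t => (Num.sqrt t + e)^-1)) /\
  star (x * fc (star x * x) (fun t => (Num.sqrt t + e)^-1)) * x = abs_approx x e.
Proof.
move=> e0; have pw := psd_sqr x; set w := star x * x in pw *.
have ck := cts_inv_sqrt_addn e0; have ckt := cts_inv_sqrt_addn_mul e0.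
have sk : star (x * fc w (fun t => (Num.sqrt t + e)^-1)) * x = abs_approx x e.
  rewrite starM star_fc // -mulrA -/w /abs_approx -/w fcM //; last exact: cts_id.
  by rewrite fc_id.
split=> //; apply: opb_psd_sqr => //; rewrite expr1n mulrA sk /abs_approx -/w.
rewrite -fcM // -(fc_cst 1 pw) -fcB //; [|exact: cts_cst|exact: ctsM].
apply: fc_psd => //; first by apply: ctsB; [exact: cts_cst|exact: ctsM].
move=> t t0; rewrite subr_ge0.
have s0 := sqrtr_ge0 t; have se := sqrt_addn_gt0 t e0.
rewrite mulrAC -invfM ler_pdivrMl ?mulr_gt0 // mulr1 -{1}(sqr_sqrtr t0).
nra.
Qed.

Lemma abs_approx_mono x d e : 0 < d -> d <= e -> psd (abs_approx x d - abs_approx x e).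
Proof.
move=> d0 de; have e0 : 0 < e by exact: lt_le_trans de.
have pw := psd_sqr x; rewrite -fcB //; [|exact: cts_inv_sqrt_addn_mul|exact: cts_inv_sqrt_addn_mul].
apply: fc_psd => //; first by apply: ctsB; exact: cts_inv_sqrt_addn_mul.
move=> t t0; rewrite subr_ge0 ler_wpM2r // lef_pV2 ?posrE ?sqrt_addn_gt0 //.
by rewrite lerD2l.
Qed.

Lemma babs_sqrt x : babs x = fc (star x * x) Num.sqrt.
Proof. by apply: fc_ext => [|t t0]; [exact: psd_sqr|rewrite powR12_sqrt]. Qed.

Lemma sqrt_sub_approx (e t : R) : 0 < e -> 0 <= t ->
  0 <= Num.sqrt t - (Num.sqrt t + e)^-1 * t <= e.
Proof.
move=> e0 t0; have s0 := sqrtr_ge0 t; have se := sqrt_addn_gt0 t e0.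
have -> : Num.sqrt t - (Num.sqrt t + e)^-1 * t = (Num.sqrt t * e) / (Num.sqrt t + e).
  by rewrite -[X in _ * X](sqr_sqrtr t0); field; rewrite gt_eqF.
rewrite divr_ge0 ?(ltW se) ?mulr_ge0 ?(ltW e0) //= ler_pdivrMr //.
by rewrite mulrDr mulrC lerDl mulr_ge0 // ltW.
Qed.

Lemma abs_approx_le x e : 0 < e -> psd (babs x - abs_approx x e).
Proof.
move=> e0; have pw := psd_sqr x.
rewrite babs_sqrt -fcB //; [|exact: cts_sqrt|exact: cts_inv_sqrt_addn_mul].
apply: fc_psd => //; first by apply: ctsB; [exact: cts_sqrt|exact: cts_inv_sqrt_addn_mul].
by move=> t t0; have /andP[] := sqrt_sub_approx e0 t0.
Qed.

Lemma abs_approx_ge x e : 0 < e -> psd (sca e - (babs x - abs_approx x e)).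
Proof.
move=> e0; have pw := psd_sqr x; have cs := ctsB (@cts_sqrt R) (cts_inv_sqrt_addn_mul e0).
rewrite babs_sqrt -fcB //; [|exact: cts_sqrt|exact: cts_inv_sqrt_addn_mul].
rewrite -(fc_cst e pw) -fcB //; last exact: cts_cst.
apply: fc_psd => //; first by apply: ctsB => //; exact: cts_cst.
by move=> t t0; have /andP[_] := sqrt_sub_approx e0 t0; rewrite subr_ge0.
Qed.

Variables (M : set (H -> H)) (tr : (H -> H) -> \bar R).
Hypotheses (hM : von_neumann_algebra M) (htr_normal : trace_normal M tr).

Lemma inM_abs_approx x e : 0 < e -> inM M x -> inM M (abs_approx x e).
Proof.
move=> e0 mx; apply: (inM_fc hM _ (psd_sqr x) (cts_inv_sqrt_addn_mul e0)).
by apply: (inMM hM) => //; exact: (inM_star hM).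
Qed.

Lemma inM_babs x : inM M x -> inM M (babs x).
Proof.
move=> mx; apply: (inM_pw hM _ (psd_sqr x)); last by rewrite invr_ge0.
by apply: (inMM hM) => //; exact: (inM_star hM).
Qed.

Lemma psd_babs x : psd (babs x).
Proof. by apply: psd_pw; [exact: psd_sqr|rewrite invr_ge0]. Qed.

(** The operators [abs_approx x e] increase as [e] decreases and stay within [e] of [babs x], which
    is therefore their least upper bound; normality then passes the estimate to the supremum. *)
Lemma trb_babs_le x (S : \bar R) : inM M x ->
  (forall e, 0 < e -> (trb tr (abs_approx x e) <= S)%E) -> (trb tr (babs x) <= S)%E.
Proof.
move=> mx hS.
pose D := [set y : H -> H | exists2 e : R, 0 < e & y = abs_approx x e].
have lub : op_lub M D (babs x).
  split; first by apply: pos_coneP; [exact: inM_babs|exact: psd_babs].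
    by move=> _ [e e0 ->]; apply/(positive_opP (_ - _)); exact: abs_approx_le.
  move=> y [my py] hy; have [y' ey psy] := positive_op_bh py; rewrite -ey in hy *.
  apply/(positive_opP (_ - _)); split.
    by rewrite starB !psd_sa //; exact: psd_babs.
  move=> u; rewrite leNgt; apply/negP => neg.
  (* If the form of [y' - babs x] equals [- delta] at [u], the bound by [abs_approx x e] forces
     delta <= e |u|^2, whereas this [e] makes e |u|^2 at most delta / 2. *)
  pose e := - rdot ((y' - babs x) u) u / (2 * (rdot u u + 1)).
  have r0 := rdot_ge0 u.
  have e0 : 0 < e by rewrite /e divr_gt0 ?oppr_gt0 // mulr_gt0 // ltr_wpDl.
  have /(positive_opP (_ - _))[_ /(_ u) h1] := hy _ (ex_intro2 _ _ e e0 erefl).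
  have [_ /(_ u) h2] := abs_approx_ge x e0.
  have h3 : - rdot ((y' - babs x) u) u <= e * rdot u u.
    move: h1 h2; rewrite !bhB scaE !rdotBl rdotZl; lra.
  have r1 : 0 < 2 * (rdot u u + 1) by rewrite mulr_gt0 // ltr_wpDl.
  have ee : e * (2 * (rdot u u + 1)) = - rdot ((y' - babs x) u) u by rewrite /e divfK ?gt_eqF.
  clearbody e.
  have : 0 <= e * rdot u u by rewrite mulr_ge0 // ltW.
  lra.
have dir : op_directed D.
  split; first by exists (abs_approx x 1); exists 1.
  move=> _ _ [d d0 ->] [e e0 ->]; have m0 : 0 < Num.min d e by rewrite lt_min d0.
  exists (abs_approx x (Num.min d e)); split; first by exists (Num.min d e).
    by apply/(positive_opP (_ - _)); apply: abs_approx_mono => //; rewrite ge_min lexx.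
  by apply/(positive_opP (_ - _)); apply: abs_approx_mono => //; rewrite ge_min lexx orbT.
have Dpos : D `<=` pos_cone M.
  move=> _ [e e0 ->]; apply: pos_coneP; [exact: inM_abs_approx|exact: psd_abs_approx].
rewrite /trb (htr_normal Dpos dir lub); apply: ge_ereal_sup.
by move=> _ [_ [e e0 ->] <-]; exact: hS.
Qed.

Lemma babs_psd x : psd x -> babs x = x.
Proof.
move=> px; rewrite /babs psd_sa // -{1 2}(pw1 px) -pwD // pw_pw ?addr_ge0 ?invr_ge0 //.
by rewrite mulrDl mul1r -[2^-1]mul1r -splitr pw1.
Qed.

End AbsoluteValue.


Theorem theorem3p1 (R : realType) (H : hilbertType R) (M : set (H -> H))
    (hM : von_neumann_algebra M) (hMsf : semifinite_algebra M)
    (tr : (H -> H) -> \bar R) (htr : is_trace M tr)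
    (htr_faithful : trace_faithful M tr)
    (htr_semifinite : trace_semifinite M tr)
    (htr_normal : trace_normal M tr)
    (p q : R) (hp : 0 < p) (hq : 0 < q) (hpq : p^-1 + q^-1 = 1)
    (a b : H -> H) (haM : M a) (hbM : M b)
    (ha : positive_op a) (hb : positive_op b)
    (hatr : (tr a < +oo)%E) (hbtr : (tr b < +oo)%E) :
  tr (op_abs (a \o b)) =
    ((p^-1)%:E * tr (op_pow a p) + (q^-1)%:E * tr (op_pow b q))%E
  <-> op_pow b q = op_pow a p.
Proof.
have [a' ea pa] := positive_op_bh ha; have [b' eb pb] := positive_op_bh hb.
subst a b; rename a' into a; rename b' into b.
have p0 := ltW hp; have q0 := ltW hq.
have fa : fintr M tr a by [].
have fb : fintr M tr b by [].
rewrite !op_powE // -[bh_fun a \o bh_fun b]/(bh_fun (a * b)) op_absE.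
have la := L2_pw_half_a hM htr fa hp hq hpq.
have lb := L2_pw_half_b hM htr fb hp hq hpq.
have p2 : 0 <= p / 2 by rewrite divr_ge0.
have q2 : 0 <= q / 2 by rewrite divr_ge0.
have fap : fintr M tr (pw a p).
  by have := L2_fintr hM la; rewrite (star_pw pa p2) -(pwD pa p2 p2) -splitr.
have fbq : fintr M tr (pw b q).
  by have := L2_fintr hM lb; rewrite (star_pw pb q2) -(pwD pb q2 q2) -splitr.
(* Both powers have finite trace, so the right-hand side is a real number. *)
have -> : ((p^-1)%:E * tr (pw a p) + (q^-1)%:E * tr (pw b q))%E = (young_sum tr a b p q)%:E.
  by rewrite -!/(trb tr _) !(fintrE htr).
set S := young_sum tr a b p q; split=> [e|e0]; last first.
  have {e0} e : pw b q = pw a p by apply: bh_ext => u; rewrite e0.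
  have pc := psd_pw pa p0; set c := pw a p in pc e fap *.
  have p1 : 0 <= p^-1 by rewrite invr_ge0.
  have q1 : 0 <= q^-1 by rewrite invr_ge0.
  have eA : a = pw c p^-1 by rewrite /c (pw_pw pa p0 p1) divff ?gt_eqF // (pw1 pa).
  have eB : b = pw c q^-1 by rewrite -e (pw_pw pb q0 q1) divff ?gt_eqF // (pw1 pb).
  have -> : a * b = c by rewrite eA eB -(pwD pc p1 q1) hpq (pw1 pc).
  rewrite babs_psd // /S /young_sum e -/c -mulrDl hpq mul1r.
  exact: (fintrE htr fap).
have mab : inM M (a * b) by exact: (inMM hM).
pose N := nr2 tr (pw b (q / 2) - pw a (p / 2)).
have ld := L2B hM htr lb la.
have bound : (trb tr (babs (a * b)%R) <= (S - Num.min p^-1 q^-1 * N / 2)%:E)%E.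
  apply: (trb_babs_le hM htr_normal mab) => d d0.
  have [hu eu] := abs_approx_contraction (a * b) d0.
  have mu : inM M (a * b * fc (star (a * b) * (a * b)) (fun t => (Num.sqrt t + d)^-1)).
    apply: (inMM hM) => //; apply: (inM_fc hM _ (psd_sqr _)).
      by apply: (inMM hM) => //; exact: (inM_star hM).
    exact: cts_inv_sqrt_addn.
  have [fz hz] := young_pairing_le hM htr fa fb hp hq hpq mu hu (psd_abs_approx _ d0) eu.
  by rewrite (fintrE htr fz) lee_fin.
have N0 : 0 <= N by exact: (nr2_ge0 hM htr).
have m0 : 0 < Num.min p^-1 q^-1 by rewrite lt_min !invr_gt0 hp.
(* The assumed equality turns [bound] into S <= S - m N / 2 with m > 0. *)
have N00 : N = 0.
  move: bound; rewrite /trb e lee_fin; set m := Num.min _ _ in m0 *; nra.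
have d0 : pw b (q / 2) - pw a (p / 2) = 0.
  have [mD pD tD] := L2_fintr hM ld.
  apply: star_sqr_eq0; apply: bh_ext => u.
  (* Faithfulness yields an equation between bare maps, hence the passage through values at [u]. *)
  have -> // : bh_fun (star (pw b (q / 2) - pw a (p / 2)) * (pw b (q / 2) - pw a (p / 2))) = 0.
  apply: htr_faithful; first exact: pos_coneP.
  by have := fintrE htr (L2_fintr hM ld); rewrite -/(nr2 tr _) -/N N00.
have {}d0 : pw b (q / 2) = pw a (p / 2) by apply/eqP; rewrite -subr_eq0 d0.
by rewrite [q]splitr [p]splitr (pwD pb q2 q2) (pwD pa p2 p2) d0.
Qed.
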